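(* Let $0<q<1$. For every $n\in\mathbb{N}=\{1,2,3,\dots\}$, $$\zeta_q(2n)=(-1)^{n-1}2^{2n-1}\frac{\beta_{2n}(q)}{[2n]!},\qquad \zeta_q^{*}(2n)=(-1)^{n}2^{2n-2}\,\frac{\widetilde{E}_{2n-1}(q)}{[2n-1]!}.$$
   Context: Fix $0<q<1$. $(x;q)_\infty=\prod_{j\ge 0}(1-xq^j)$, $[n]=\frac{1-q^n}{1-q}$, $[n]!=\prod_{k=1}^n[k]$, $[0]!=1$. $E_q(z)=(-(1-q)z;q)_\infty$ (entire) and $e_q(z)=1/((1-q)z;q)_\infty$ (meromorphic). $\mathrm{Sin}_q z=\frac{E_q(iz)-E_q(-iz)}{2i}$ and $\mathrm{Cos}_q z=\frac{E_q(iz)+E_q(-iz)}{2}$. All zeros of these functions are real and simple; $(\xi_k)_{k\ge1}$ and $(\eta_k)_{k\ge1}$ denote the positive zeros of $\mathrm{Sin}_q$ and $\mathrm{Cos}_q$ respectively, in increasing order. Primes denote ordinary derivatives. $$\zeta_q(s)=\sum_{k=1}^{\infty}\frac{\mathrm{Cos}_q\xi_k}{\mathrm{Sin}_q'\xi_k}\frac1{\xi_k^s},\qquad \zeta_q^*(s)=-\sum_{k=1}^{\infty}\frac{\mathrm{Sin}_q\eta_k}{\mathrm{Cos}_q'\eta_k}\frac1{\eta_k^s}.$$ The $q$-Bernoulli numbers $\beta_n(q)$ and the $q$-Euler numbers of the first kind $\widetilde E_n(q)$ are defined by the expansions near $t=0$ $$\frac{t}{e_q(t/2)E_q(t/2)-1}=\sum_{n\ge0}\beta_n(q)\frac{t^n}{[n]!},\qquad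 \frac{2}{e_q(t/2)E_q(t/2)+1}=\sum_{n\ge0}\widetilde E_n(q)\frac{t^n}{[n]!}.$$ *)

(* Defs.v *)
From HB Require Import structures.
From mathcomp Require Import all_boot all_order all_algebra.
From mathcomp Require Import all_classical all_reals all_analysis.
From mathcomp Require Import complex.

Set Implicit Arguments.
Unset Strict Implicit.
Unset Printing Implicit Defensive.

Import Order.TTheory GRing.Theory Num.Theory.
Import numFieldNormedType.Exports.

Local Open Scope classical_set_scope.
Local Open Scope ring_scope.
Local Open Scope complex_scope.

(* [R[i]^o] carries the topology of the complex modulus; it is transferred to
   [R[i]], so that limits and [derive1] below are those of complex analysis. *)
Local Set Warnings "-redundant-canonical-projection".
HB.instance Definition _ (R : realType) := NormedModule.copy R[i] R[i]^o.
Local Set Warnings "redundant-canonical-projection".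

Section QFunctions.
Variables (R : realType) (q : R).
Implicit Types (z t s : R[i]) (f : R[i] -> R[i]).

Definition qpochhammer z : R[i] :=
  limn (fun n => \prod_(0 <= j < n) (1 - z * q%:C ^+ j)).

Definition qnumber (n : nat) : R := (1 - q ^+ n) / (1 - q).

Definition qfactorial (n : nat) : R := \prod_(1 <= k < n.+1) qnumber k.

Definition E_q z : R[i] := qpochhammer (- (1 - q%:C) * z).

(* [e_q] is meromorphic; division by zero gives it the value 0 at its poles. *)
Definition e_q z : R[i] := 1 / qpochhammer ((1 - q%:C) * z).

Definition Sin_q z : R[i] := (E_q ('i%C * z) - E_q (- ('i%C * z))) / (2 * 'i%C).

Definition Cos_q z : R[i] := (E_q ('i%C * z) + E_q (- ('i%C * z))) / 2.

Definition enumerates_positive_zeros f (u : R^nat) : Prop :=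
  increasing_seq u /\ range u = [set x : R | 0 < x /\ f x%:C = 0].

(* The enumeration is indexed from 0: term [k] is the zero of index [k + 1].
   An increasing enumeration is unique, so [get] makes no arbitrary choice. *)
Definition positive_zeros f : R^nat :=
  get [set u : R^nat | enumerates_positive_zeros f u].

Definition xi : R^nat := positive_zeros Sin_q.

Definition eta : R^nat := positive_zeros Cos_q.

(* x ^ s = exp (s ln x) for real x > 0 and complex s. *)
Definition cpow (x : R) s : R[i] :=
  (x `^ complex.Re s)%:C *
  (cos (complex.Im s * ln x) +i* sin (complex.Im s * ln x)).

Definition zeta_series s : (R[i])^nat :=
  series (fun k => Cos_q (xi k)%:C / derive1 Sin_q (xi k)%:C *
                   (1 / cpow (xi k) s)).

Definition zeta_q s : R[i] := limn (zeta_series s).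

Definition zeta_star_series s : (R[i])^nat :=
  series (fun k => Sin_q (eta k)%:C / derive1 Cos_q (eta k)%:C *
                   (1 / cpow (eta k) s)).

Definition zeta_star_q s : R[i] := - limn (zeta_star_series s).

(* The neighbourhood is punctured because the quotient defining the Bernoulli
   numbers has the form 0 / 0 at t = 0. The coefficients of such an expansion
   are unique. *)
Definition expands_near0 f (a : (R[i])^nat) : Prop :=
  \forall t \near 0^',
    series (fun n => a n * (t ^+ n / (qfactorial n)%:C)) @ \oo --> f t.

Definition expansion_coefficients f : (R[i])^nat :=
  get [set a : (R[i])^nat | expands_near0 f a].

Definition qBernoulli : (R[i])^nat :=
  expansion_coefficients (fun t => t / (e_q (t / 2) * E_q (t / 2) - 1)).

Definition qEuler : (R[i])^nat :=
  expansion_coefficients (fun t => 2 / (e_q (t / 2) * E_q (t / 2) + 1)).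

End QFunctions.

(* Main.v *)
Require Import Defs.
From mathcomp Require Import all_boot all_order all_algebra.
From mathcomp Require Import all_classical all_reals all_analysis.
From mathcomp Require Import complex ring lra zify.

(* With weights w_j = (1 - q) q^j, the value E_q(ix) at a real x has argument
   theta(x) = sum_j atan(w_j x).  Hence the positive zeros of Sin_q and Cos_q
   are the solutions of theta = (k + 1) pi and theta = (k + 1/2) pi, and the
   coefficients of the two zeta series are 1 / theta' at these zeros.  Truncating
   the product after N factors, N odd for Sin_q and even for Cos_q, turns
   Cos_q / Sin_q and - Sin_q / Cos_q into rational functions whose N poles are
   all real and simple; their partial fraction decompositions express the
   truncated zeta sums through Taylor coefficients at 0.  The k-th zero is at
   least alpha q^(-2k) uniformly in N, so x^2 theta'(x) grows geometrically along
   the zeros and dominated convergence gives the power series of z Cos_q / Sin_q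
   and - z Sin_q / Cos_q.  The substitution t = 2iz identifies them with the two
   generating functions. *)

Set Implicit Arguments.
Unset Strict Implicit.
Unset Printing Implicit Defensive.

Import Order.TTheory GRing.Theory Num.Theory.
Import numFieldNormedType.Exports.

Local Open Scope classical_set_scope.
Local Open Scope ring_scope.
Local Open Scope complex_scope.

(** Truncation replaces contour estimates for a meromorphic function by Lagrange interpolation. The
    parity of N has two effects: the leading coefficient of the numerator cancels, so that no
    polynomial part appears, and the real zeros read off from the phase are as many as the degree of
    the denominator allows, so that none escapes. The price is that the zeros move with N. They are
    controlled because the weights sum to at most 1: the phases, their derivatives and the
    remainders of the products obey bounds whose constants do not involve N, and limits may be taken
    at moving points. The coefficient 1 / theta' arises because the denominator is, on the real
    line, the imaginary part of a fixed multiple of E_q(ix); where it vanishes, its derivative sees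
    the change of the argument and not that of the modulus. Estimates are kept multiplied by the
    denominator, since its limit is not known in advance to be nonzero. *)

Local Notation normc := ComplexField.Normc.normc.

(** * Real analysis *)

Section RealFacts.
Variable R : realType.
Implicit Types x y u v : R.

Lemma atan_lipschitz x y : `|atan y - atan x| <= `|y - x|.
Proof.
wlog xy : x y / x < y => [hw|].
  have [xy|yx|->] := ltgtP x y; first exact: hw.
    by rewrite distrC [leRHS]distrC; exact: hw.
  by rewrite !subrr.
have datan z : z \in `]x, y[ -> is_derive z 1 atan (1 + z ^+ 2)^-1.
  by move=> _; exact: is_derive1_atan.
have catan : {within `[x, y], continuous (@atan R)}.
  by apply: continuous_subspaceT => z; exact: continuous_atan.
have [c _ ->] := MVT xy datan catan.
rewrite normrM ler_piMl// ger0_norm ?invr_ge0 ?addr_ge0 ?sqr_ge0//.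
by rewrite invf_le1 ?lerDl ?sqr_ge0// ltr_wpDr ?sqr_ge0.
Qed.

Lemma sin_atan x : sin (atan x) = x * cos (atan x).
Proof.
have c0 : cos (atan x) != 0 :> R.
  by rewrite cos_atan invr_eq0 sqrtr_eq0 -ltNge ltr_wpDr ?sqr_ge0.
by rewrite -{2}(atanK x) /tan mulfVK.
Qed.

(** A positive phase minus [alpha] stays above [- pi]; the sine is negative between [- pi] and 0, so
    only nonnegative multiples of pi remain. *)
Lemma sin_addpi_eq0 u : - pi < u -> sin u = 0 -> exists k : nat, u = k%:R * pi.
Proof.
move=> upi su; have pi0 := pi_gt0 R.
have [u0|u0] := ltP u 0.
  have : sin (- u) > 0 by apply: sin_gt0_pi; rewrite oppr_gt0 u0 ltrNl.
  by rewrite sinN su oppr0 ltxx.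
exists (Num.truncn (u / pi)).
set k := Num.truncn _.
have /andP[k1 k2] : k%:R <= u / pi < k.+1%:R.
  by apply: truncn_itv; rewrite divr_ge0// ltW.
have {k1 k2} [k1 k2] : k%:R * pi <= u /\ u < k%:R * pi + pi.
  split; first by rewrite -ler_pdivlMr.
  by rewrite -[X in _ + X]mul1r -mulrDl natr1 -ltr_pdivrMr.
have sk m v : sin (v + m%:R * pi) = (-1) ^+ m * sin v.
  elim: m => [|m IH]; first by rewrite mul0r addr0 expr0 mul1r.
  by rewrite -natr1 mulrDl mul1r addrA sinDpi IH exprS mulN1r mulNr.
have := sk k (u - k%:R * pi); rewrite subrK su.
move/esym/eqP; rewrite mulf_eq0 signr_eq0/= => /eqP s0.
have [ku|ku|//] := ltgtP (k%:R * pi) u.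
  have : sin (u - k%:R * pi) > 0 by apply: sin_gt0_pi; lra.
  by rewrite s0 ltxx.
by move: ku; rewrite ltNge k1.
Qed.

Lemma cvgn_unique (u : R^nat) (a b : R) :
  u @ \oo --> a -> u @ \oo --> b -> a = b.
Proof. by move=> ua ub; apply: cvg_unique ua ub. Qed.

(** Dominated convergence for triangular sums. Domination is asked only for [k < m], since the
    entries used later are meaningless beyond that range. Once the tail of [D] after [K] is below
    [e / 4], the head and the tails of [T] and [t] cost at most [e / 4] each. *)
Lemma tannery (T : nat -> nat -> R) (t D : R^nat) :
  (forall m k, (k < m)%N -> 0 <= T m k <= D k) ->
  (forall k, T ^~ k @ \oo --> t k) ->
  cvgn (series D) ->
  cvgn (series t) /\
  (fun m => \sum_(k < m) T m k) @ \oo --> limn (series t).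
Proof.
move=> TD Tt Dcvg.
have tD k : 0 <= t k <= D k.
  apply/andP; split.
    apply: (cvgr_to_ge (Tt k)).
    by exists k.+1 => // m /= /TD /andP[].
  apply: (cvgr_to_le (Tt k)).
  by exists k.+1 => // m /= /TD /andP[].
have D0 k : 0 <= D k by have /andP[/le_trans] := tD k; apply.
have t0 k : 0 <= t k by have /andP[] := tD k.
have tcvg : cvgn (series t).
  by apply: series_le_cvg Dcvg => // k; have /andP[] := tD k.
split=> //; apply/cvgrPdist_lt => e e0.
have e40 : 0 < e / 4 by rewrite divr_gt0.
have serD_le m : series D m <= limn (series D).
  apply: (nondecreasing_cvgn_le _ Dcvg); apply/nondecreasing_seqP => j.
  by rewrite seriesSr lerDl.
have [K _ tailK] : \forall K \near \oo, `|limn (series D) - series D K| < e / 4.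
  by move/cvgrPdist_lt : Dcvg; apply.
have {tailK} tailK : limn (series D) - series D K < e / 4.
  by have := tailK K (leqnn K); rewrite ger0_norm// subr_ge0.
have head : (fun m => \sum_(0 <= k < K) T m k) @ \oo --> series t K.
  rewrite /series/=; elim: (K) => [|k IH].
    by under eq_fun do rewrite big_geq//; rewrite big_geq//; exact: cvg_cst.
  under eq_fun do rewrite big_nat_recr//=.
  by rewrite big_nat_recr//=; apply: cvgD => //; exact: Tt.
have sumDK m : (K <= m)%N -> \sum_(K <= k < m) D k < e / 4.
  move=> Km; apply: le_lt_trans tailK; rewrite -sub_series_geq//.
  by rewrite lerD2r.
have tailt : limn (series t) - series t K <= e / 4.
  rewrite lerBlDr; apply: limr_le => //; near=> m; have Km : (K <= m)%N by near: m; exists K.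
  rewrite -lerBlDr sub_series_geq//.
  apply: le_trans (ltW (sumDK m Km)); apply: ler_sum_nat => k _.
  by have /andP[] := tD k.
have tailt0 : 0 <= limn (series t) - series t K.
  rewrite subr_ge0; apply: (nondecreasing_cvgn_le _ tcvg).
  by apply/nondecreasing_seqP => m; rewrite seriesSr lerDl.
move/cvgrPdist_lt : head => /(_ _ e40); case=> M _ headM.
exists (maxn K M) => // m /=; rewrite geq_max => /andP[Km Mm].
have h1 := headM m Mm; rewrite /= in h1.
rewrite -(big_mkord xpredT (T m)) (big_cat_nat (n := K))//=.
have h2 : \sum_(K <= k < m) T m k < e / 4.
  apply: le_lt_trans (sumDK m Km); apply: ler_sum_nat => k /andP[_ km].
  by have /andP[] := TD _ _ km.
have h3 : 0 <= \sum_(K <= k < m) T m k.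
  rewrite big_nat; apply: sumr_ge0 => k /andP[_ km].
  by have /andP[] := TD _ _ km.
move: h1; rewrite !ltr_norml => /andP[h4 h5]; apply/andP; split; lra.
Unshelve. all: by end_near. Qed.

End RealFacts.

(** * The phase of the truncated products *)

Section Phase.
Variables (R : realType) (q : R).
Hypothesis q01 : 0 < q < 1.
Implicit Types x y : R.

Definition weight (j : nat) : R := (1 - q) * q ^+ j.

Definition phase (N : nat) x : R := \sum_(j < N) atan (weight j * x).

(* The derivative of [phase N]. *)
Definition slope (N : nat) x : R :=
  \sum_(j < N) weight j / (1 + (weight j * x) ^+ 2).

Lemma weight_gt0 j : 0 < weight j.
Proof. by case/andP: q01 => q0 q1; rewrite mulr_gt0 ?exprn_gt0 ?subr_gt0. Qed.

Lemma weight_ge0 j : 0 <= weight j.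
Proof. exact/ltW/weight_gt0. Qed.

Lemma weight_le1 j : weight j <= 1.
Proof.
case/andP: q01 => q0 q1; have := exprn_ile1 j (ltW q0) (ltW q1).
have := exprn_ge0 j (ltW q0); rewrite /weight; nra.
Qed.

Lemma sum_weight N : \sum_(j < N) weight j = 1 - q ^+ N.
Proof.
elim: N => [|N IH]; first by rewrite big_ord0 expr0 subrr.
by rewrite big_ord_recr/= IH /weight exprS; ring.
Qed.

Lemma sum_weight_le1 N : \sum_(j < N) weight j <= 1.
Proof.
by case/andP: q01 => q0 q1; rewrite sum_weight gerBl exprn_ge0 ?ltW.
Qed.

Lemma sum_weight_lipschitz (f : nat -> R -> R) :
    (forall j x y, `|f j y - f j x| <= weight j * `|y - x|) ->
  forall N x y,
    `|\sum_(j < N) f j y - \sum_(j < N) f j x| <= `|y - x|.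
Proof.
move=> flip N x y; rewrite -sumrB; apply: le_trans (ler_norm_sum _ _ _) _.
apply: (@le_trans _ _ (\sum_(j < N) weight j * `|y - x|)).
  by apply: ler_sum => j _; exact: flip.
by rewrite -mulr_suml ler_piMl ?sum_weight_le1.
Qed.

Lemma phase_lipschitz N x y : `|phase N y - phase N x| <= `|y - x|.
Proof.
apply: (sum_weight_lipschitz (f := fun j x => atan (weight j * x))).
move=> j u v; apply: le_trans (atan_lipschitz _ _) _.
by rewrite -mulrBr normrM ger0_norm// weight_ge0.
Qed.

Lemma slope_lipschitz N x y : `|slope N y - slope N x| <= `|y - x|.
Proof.
apply: (sum_weight_lipschitz
  (f := fun j x => weight j / (1 + (weight j * x) ^+ 2))).
move=> j u v; set a := weight j.
have a0 : 0 < a := weight_gt0 j.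
have U0 : 0 < 1 + (a * u) ^+ 2 by rewrite ltr_wpDr ?sqr_ge0.
have V0 : 0 < 1 + (a * v) ^+ 2 by rewrite ltr_wpDr ?sqr_ge0.
rewrite -mulrBr normrM (gtr0_norm a0) ler_pM2l//.
have -> : (1 + (a * v) ^+ 2)^-1 - (1 + (a * u) ^+ 2)^-1 =
    (v - u) * (- (a * (a * u + a * v)) /
       ((1 + (a * v) ^+ 2) * (1 + (a * u) ^+ 2))).
  by field; rewrite !gt_eqF.
rewrite normrM ler_piMr// normrM normfV normrN normrM (gtr0_norm a0).
rewrite [X in _ / X]gtr0_norm ?mulr_gt0// ler_pdivrMr ?mulr_gt0// mul1r.
apply: (@le_trans _ _ `|a * u + a * v|).
  by rewrite ler_piMl// weight_le1.
(* With s = x' + y', 2|s| <= 1 + s^2 and s^2 <= 2 (x'^2 + y'^2), so |s| is at most the product of 1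
   + x'^2 and 1 + y'^2. *)
set x' := a * u; set y' := a * v.
have := mulr_ge0 (sqr_ge0 x') (sqr_ge0 y').
have := sqr_ge0 (x' - y'); have := sqr_ge0 (x' + y' - 1).
have := sqr_ge0 (x' + y' + 1).
by rewrite ler_norml => *; apply/andP; split; lra.
Qed.

Lemma phase_continuous N : continuous (phase N).
Proof.
move=> x; apply/cvgrPdist_lt => e e0; near=> y.
rewrite distrC; apply: le_lt_trans (phase_lipschitz _ _ _) _.
rewrite distrC; near: y; exact: cvgr_dist_lt.
Unshelve. all: by end_near. Qed.

Lemma phase0 N : phase N 0 = 0.
Proof. by rewrite /phase big1// => j _; rewrite mulr0 atan0. Qed.

Lemma phaseN N x : phase N (- x) = - phase N x.
Proof. by rewrite /phase -sumrN; apply: eq_bigr => j _; rewrite mulrN atanN. Qed.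

Lemma slopeN N x : slope N (- x) = slope N x.
Proof. by apply: eq_bigr => j _; rewrite mulrN sqrrN. Qed.

Lemma phase_lt N x y : (0 < N)%N -> x < y -> phase N x < phase N y.
Proof.
case: N => // N _ xy; rewrite /phase !big_ord_recl/=.
apply: ltr_leD; first by apply: lt_atan; rewrite ltr_pM2l ?weight_gt0.
by apply: ler_sum => j _; apply: le_atan; rewrite ler_pM2l ?weight_gt0 ?ltW.
Qed.

Lemma phase_le_nat M N x : 0 <= x -> (M <= N)%N -> phase M x <= phase N x.
Proof.
move=> x0 MN; rewrite /phase -!(big_mkord xpredT (fun j => atan (weight j * x))).
rewrite (big_cat_nat (n := M) (p := N))//= lerDl sumr_ge0// => j _.
by rewrite -atan0 le_atan// mulr_ge0// weight_ge0.
Qed.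

Lemma phase_le_id N x : 0 <= x -> phase N x <= x.
Proof.
move=> x0; have := phase_lipschitz N 0 x; rewrite phase0 !subr0 (ger0_norm x0).
exact/le_trans/ler_norm.
Qed.

Lemma slope_gt0 N x : (0 < N)%N -> 0 < slope N x.
Proof.
have pos j : 0 < weight j / (1 + (weight j * x) ^+ 2).
  by rewrite divr_gt0 ?weight_gt0// ltr_wpDr ?sqr_ge0.
case: N => // N _; rewrite /slope big_ord_recl ltr_wpDr ?pos//.
by apply: sumr_ge0 => j _; exact/ltW/pos.
Qed.

(* Each of the first [n] summands is below [pi / 2]; the remaining ones form
   the phase at [q ^+ n * x], which is at most [q ^+ n * x]. *)
Lemma phase_le_scale N n x : 0 <= x -> phase N x <= n%:R * (pi / 2) + q ^+ n * x.
Proof.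
case/andP: q01 => q0 q1.
move=> x0; have h : phase (n + N) x = phase n x + phase N (q ^+ n * x).
  rewrite /phase big_split_ord/=; congr (_ + _); apply: eq_bigr => j _.
  by rewrite /weight exprD; congr atan; ring.
apply: (le_trans (phase_le_nat x0 (leq_addl n N))); rewrite h lerD//.
  rewrite /phase; apply: (@le_trans _ _ (\sum_(j < n) (pi / 2))).
    by apply: ler_sum => j _; exact/ltW/atan_ltpi2.
  by rewrite sumr_const card_ord mulr_natl.
by apply: phase_le_id; rewrite mulr_ge0 ?exprn_ge0 ?(ltW q0).
Qed.

Definition Phase x : R := limn (phase ^~ x).
(** The limit of the derivatives: it enters the derivatives of the limit functions through estimates
    uniform in N, not by differentiating [Phase]. *)
Definition Slope x : R := limn (slope ^~ x).

Lemma phase_cvg x : 0 <= x -> phase ^~ x @ \oo --> Phase x.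
Proof.
move=> x0; apply: (nondecreasing_is_cvgn (u_ := phase ^~ x)).
  by move=> M N MN; exact: phase_le_nat.
by exists x => _ [N _ <-]; exact: phase_le_id.
Qed.

Lemma slope_cvg x : slope ^~ x @ \oo --> Slope x.
Proof.
apply: (nondecreasing_is_cvgn (u_ := slope ^~ x)).
  apply/nondecreasing_seqP => N; rewrite /slope big_ord_recr/= lerDl.
  by rewrite divr_ge0 ?weight_ge0// addr_ge0 ?sqr_ge0.
exists 1 => _ [N _ <-]; apply: le_trans (sum_weight_le1 N).
apply: ler_sum => j _; rewrite ler_piMr ?weight_ge0// invf_le1.
  by rewrite lerDl sqr_ge0.
by rewrite ltr_wpDr ?sqr_ge0.
Qed.

Lemma Phase_lt x y : 0 <= x -> x < y -> Phase x < Phase y.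
Proof.
move=> x0 xy; have y0 := le_trans x0 (ltW xy).
(* A strict inequality does not survive the limit; the increment of the summand [j = 0] is a gap
   common to all nonempty truncations. *)
pose d := atan (weight 0 * y) - atan (weight 0 * x).
have d0 : 0 < d by rewrite subr_gt0 lt_atan// ltr_pM2l ?weight_gt0.
suff : Phase x + d <= Phase y by apply: lt_le_trans; rewrite ltrDl.
apply: (ler_cvg_to (cvgD (phase_cvg x0) (cvg_cst d)) (phase_cvg y0)).
exists 1%N => // -[//|N] _.
change (phase N.+1 x + d <= phase N.+1 y); rewrite /phase !big_ord_recl/= addrAC.
rewrite /d addrCA subrr addr0 lerD2l.
by apply: ler_sum => j _; apply: le_atan; rewrite ler_pM2l ?weight_gt0 ?ltW.
Qed.

Lemma Phase_inj x y : 0 <= x -> 0 <= y -> Phase x = Phase y -> x = y.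
Proof.
move=> x0 y0 xy; have [/(Phase_lt x0)|/(Phase_lt y0)|//] := ltgtP x y.
- by rewrite xy ltxx.
- by rewrite xy ltxx.
Qed.

Lemma Phase_gt0 x : 0 < x -> 0 < Phase x.
Proof.
move=> x0; have := Phase_lt (lexx 0) x0; rewrite {1}/Phase.
under eq_fun do rewrite phase0.
by rewrite lim_cst.
Qed.

Lemma Slope_gt0 x : 0 < Slope x.
Proof.
have ndec : nondecreasing_seq (slope ^~ x).
  apply/nondecreasing_seqP => N; rewrite /slope big_ord_recr/= lerDl.
  by rewrite divr_ge0 ?weight_ge0// addr_ge0 ?sqr_ge0.
apply: (lt_le_trans (slope_gt0 x (ltn0Sn 0))).
exact: (nondecreasing_cvgn_le ndec (@slope_cvg x) 1%N).
Qed.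

(** A Lipschitz constant common to the family makes it equicontinuous, so convergence at [x] extends
    to arguments moving towards [x], here the zeros of the truncations. *)
Lemma lipschitz_cvg_diag (f : nat -> R -> R) (y : R^nat) (N : nat^nat) x (l : R) :
    (forall m u v, `|f m v - f m u| <= `|v - u|) ->
  (fun m => f (N m) x) @ \oo --> l -> y @ \oo --> x ->
  (fun m => f (N m) (y m)) @ \oo --> l.
Proof.
move=> flip fx yx.
have h0 : (fun m => `|y m - x|) @ \oo --> `|x - x|.
  exact: (cvg_norm (cvgB yx (cvg_cst x))).
rewrite subrr normr0 in h0.
have h : (fun m => f (N m) (y m) - f (N m) x) @ \oo --> 0.
  apply/norm_cvg0P; apply: (squeeze_cvgr (f := fun=> 0) (h := fun m => `|y m - x|)).
  - by near=> m; rewrite normr_ge0 flip.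
  - exact: cvg_cst.
  - exact: h0.
rewrite -[l]add0r.
under eq_fun => m do rewrite -(subrK (f (N m) x) (f (N m) (y m))).
exact: (cvgD h fx).
Unshelve. all: by end_near. Qed.

End Phase.

(* With this parity the truncated function has exactly [m] positive zeros. *)
Definition depth (b : bool) (m : nat) : nat := m.*2 + b.

Lemma depth_gt0 b m : (0 < m)%N -> (0 < depth b m)%N.
Proof. by rewrite /depth; case: m => // m _; rewrite doubleS. Qed.

Lemma depth_cvg b : depth b @ \oo --> \oo.
Proof.
apply/cvgnyPge => A; exists A => // m /=.
by rewrite /depth; lia.
Qed.

(** * Zeros of the truncations, their limits and their growth *)

Section Zeros.
Variables (R : realType) (q : R) (b : bool).
Hypothesis q01 : 0 < q < 1.

Local Notation depth := (depth b).

(* [b = true] is the case of the sine, [b = false] that of the cosine. *)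
Definition alpha : R := if b then pi else pi / 2.

Definition angle (k : nat) : R := k%:R * pi + alpha.

Lemma alpha_ge1 : 1 <= alpha.
Proof. by have := pihalf_ge1 R; rewrite /alpha; case: b; lra. Qed.

Lemma alpha_le_pi : alpha <= pi.
Proof. by have := pi_gt0 R; rewrite /alpha; case: b; lra. Qed.

Lemma angle_ge_alpha k : alpha <= angle k.
Proof. by rewrite lerDr mulr_ge0// pi_ge0. Qed.

(** The right-hand side is the supremum of the phase with [depth m] summands, so these levels are
    attained. *)
Lemma angle_lt_depth m k : (k < m)%N -> angle k < (depth m)%:R * (pi / 2).
Proof.
move=> km; have pi0 := pi_gt0 R.
have kmR : k%:R + 1 <= m%:R :> R by rewrite natr1 ler_nat.
have h : k%:R * pi + pi <= m%:R * pi :> R.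
  by rewrite -[X in _ + X]mul1r -mulrDl ler_pM2r.
rewrite /angle /depth /alpha natrD -muln2 natrM; case: b => /=.
  rewrite mulrDl mul1r -mulrA (mulrC 2) divfK//.
  by lra.
by rewrite addr0 -mulrA (mulrC 2) divfK//; lra.
Qed.

Lemma phase_root_exists m k : (k < m)%N ->
  exists y, 0 <= y /\ phase q (depth m) y = angle k.
Proof.
move=> km; set N := depth m.
have N0 : (0 < N)%N by apply: depth_gt0; exact: leq_ltn_trans km.
have NR : 0 < N%:R :> R by rewrite ltr0n.
have pi0 := pi_gt0 R.
have a0 : 0 <= angle k.
  by apply: le_trans (angle_ge_alpha k); have := alpha_ge1; lra.
(* [beta] is the share of the level falling to each of the N summands; [X] below gives exactly this
   share to the summand of smallest weight, hence at least as much to the others. *)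
pose beta := angle k / N%:R.
have beta0 : 0 <= beta by rewrite divr_ge0// ltW.
have betapi : beta < pi / 2 by rewrite ltr_pdivrMr// mulrC angle_lt_depth.
have w0 := weight_gt0 q01 N.-1.
have tan0 : 0 <= tan beta.
  rewrite /tan divr_ge0//.
    by apply: sin_ge0_pi; lra.
  by apply: cos_ge0_pihalf; lra.
pose X := tan beta / weight q N.-1.
have X0 : 0 <= X by rewrite divr_ge0// ltW.
have phX : angle k <= phase q N X.
  rewrite -(divfK (lt0r_neq0 NR) (angle k)) -/beta.
  rewrite mulr_natr -[X in _ *+ X]card_ord -sumr_const.
  apply: ler_sum => j _.
  have -> : beta = atan (tan beta) by rewrite tanK// in_itv/=; lra.
  apply: le_atan; rewrite /X mulrA ler_pdivlMr// mulrC ler_wpM2r//.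
  rewrite /weight ler_pM2l ?subr_gt0; last by case/andP: q01.
  case/andP: q01 => q0 q1.
  by apply: ler_wiXn2l; rewrite ?ltW// -ltnS prednK.
have cont : {within `[0, X], continuous (phase q N)}.
  by apply: continuous_subspaceT => z; exact: phase_continuous.
have [|y] := IVT X0 cont (v := angle k).
  by rewrite phase0 ge_min a0 le_max phX orbT.
by rewrite in_itv/= => /andP[y0 _] yk; exists y.
Qed.

(** Strict monotonicity of the phase makes the choice unique for [k < m]. For [k >= m] the level
    lies above the phase and the value is a mere default. *)
Definition finite_zero (m k : nat) : R :=
  get [set y | 0 <= y /\ phase q (depth m) y = angle k].

Lemma finite_zeroP m k : (k < m)%N ->
  0 <= finite_zero m k /\ phase q (depth m) (finite_zero m k) = angle k.
Proof.
move=> km; rewrite /finite_zero.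
by case: xgetP => [y -> //|/(_ _)]; have [y yP] := phase_root_exists km; move/(_ y)/(_ yP).
Qed.

(** Take [n = 2k] in [phase_le_scale]: the first 2k arctangents account for at most k pi of the
    level, so the remaining [alpha] must come from the rescaled phase, which is at most its
    argument. *)
Lemma finite_zero_ge m k : (k < m)%N -> alpha <= q ^+ k.*2 * finite_zero m k.
Proof.
move=> km; have [y0 yk] := finite_zeroP km.
have := phase_le_scale q01 (depth m) k.*2 y0.
rewrite yk /angle -muln2 natrM -mulrA (mulrC 2) divfK// lerD2l.
by rewrite mulnC.
Qed.

Lemma finite_zero_ge1 m k : (k < m)%N -> 1 <= finite_zero m k.
Proof.
move=> km; apply: le_trans alpha_ge1 _; apply: le_trans (finite_zero_ge km) _.
have [y0 _] := finite_zeroP km; case/andP: q01 => q0 q1.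
by rewrite ler_piMl// exprn_ile1// ltW.
Qed.

(** More factors raise the phase on the positive axis, so a given level is reached earlier. With the
    lower bound 1 this yields the limit zeros. *)
Lemma finite_zero_nonincr m k : (k < m)%N -> finite_zero m.+1 k <= finite_zero m k.
Proof.
move=> km; have [y0 yk] := finite_zeroP km.
have [y'0 y'k] := finite_zeroP (ltnW km : (k < m.+1)%N).
rewrite leNgt; apply/negP => /(phase_lt q01 (depth_gt0 b (ltn0Sn m))).
apply/negP; rewrite -leNgt y'k -yk; apply: phase_le_nat => //.
by rewrite /depth; lia.
Qed.

Definition zero (k : nat) : R := limn (finite_zero ^~ k).

Lemma finite_zero_cvg k : finite_zero ^~ k @ \oo --> zero k.
Proof.
suff : cvgn (finite_zero ^~ k) by [].
apply: (@near_nonincreasing_is_cvgn _ _ 1); last first.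
  by exists k.+1 => // m /=; exact: finite_zero_ge1.
exists k.+1 => // i /= ki j ij.
suff h d : finite_zero (i + d) k <= finite_zero i k.
  by rewrite -(subnKC ij) h.
elim: d => [|d IH]; first by rewrite addn0.
by rewrite addnS; apply: le_trans IH; apply: finite_zero_nonincr; rewrite ltn_addr.
Qed.

Lemma zero_ge1 k : 1 <= zero k.
Proof.
apply: (cvgr_to_ge (@finite_zero_cvg k)).
by exists k.+1 => // m /=; exact: finite_zero_ge1.
Qed.

Lemma zero_ge0 k : 0 <= zero k.
Proof. by apply: le_trans (zero_ge1 k). Qed.

Lemma Phase_zero k : Phase q (zero k) = angle k.
Proof.
have phd : (fun m => phase q (depth m) (zero k)) @ \oo --> Phase q (zero k).
  exact: (cvg_comp _ _ (@depth_cvg b) (phase_cvg q01 (zero_ge0 k))).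
have := lipschitz_cvg_diag (fun m u v => phase_lipschitz q01 m u v)
  phd (@finite_zero_cvg k).
move/cvgn_unique; apply; apply: cvg_near_cst.
by exists k.+1 => // m /= km; have [] := finite_zeroP km.
Qed.

Lemma slope_finite_zero_cvg k :
  (fun m => slope q (depth m) (finite_zero m k)) @ \oo --> Slope q (zero k).
Proof.
have sld : (fun m => slope q (depth m) (zero k)) @ \oo --> Slope q (zero k).
  exact: (cvg_comp _ _ (@depth_cvg b) (@slope_cvg _ _ q01 (zero k))).
exact: (lipschitz_cvg_diag (fun m u v => slope_lipschitz q01 m u v)
  sld (@finite_zero_cvg k)).
Qed.

Lemma zero_lt k l : (zero k < zero l) = (k < l)%N.
Proof.
have inc i j : (i < j)%N -> zero i < zero j.
  move=> ij; rewrite ltNge; apply/negP => ji.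
  have : Phase q (zero j) <= Phase q (zero i).
    move: ji; rewrite le_eqVlt => /predU1P[->//|].
    by move/(Phase_lt q01 (zero_ge0 j))/ltW.
  by rewrite !Phase_zero lerD2r ler_pM2r ?pi_gt0// ler_nat leqNgt ij.
have [kl|lk|->] := ltngtP k l; [exact: inc| |by rewrite ltxx].
by apply/negbTE; rewrite -leNgt; exact/ltW/inc.
Qed.

Lemma zero_onto x : 0 < x -> sin (Phase q x - alpha) = 0 -> exists k, zero k = x.
Proof.
move=> x0 /sin_addpi_eq0[|k phx].
  by have := Phase_gt0 q01 x0; have := alpha_le_pi; lra.
exists k; apply: (Phase_inj q01 (zero_ge0 k) (ltW x0)).
by rewrite Phase_zero /angle -phx subrK.
Qed.

Definition dominant : R := (1 - q) * (1 + ((1 - q) * alpha) ^- 2).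

(** Of the sum [slope] only the term [j = 2k] is kept, an index below [depth m]. There weight times
    zero is at least [(1 - q) * alpha] by [finite_zero_ge], so the reciprocal is at most a constant
    times the weight, which is [(1 - q) * q ^+ k.*2]. *)
Lemma slope_dominated m k : (k < m)%N ->
  (finite_zero m k ^+ 2 * slope q (depth m) (finite_zero m k))^-1
    <= dominant * (q ^+ 2) ^+ k.
Proof.
move=> km; set y := finite_zero m k; set N := depth m.
case/andP: (q01) => q0 q1; have := alpha_ge1 => a1.
have kN : (k.*2 < N)%N by rewrite /N /depth; lia.
have y1 : 1 <= y := finite_zero_ge1 km.
set w := weight q k.*2; have w0 : 0 < w := weight_gt0 q01 _.
set d := (1 - q) * alpha; have d0 : 0 < d by rewrite mulr_gt0; lra.
have dwy : d <= w * y.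
  by rewrite /d /w /weight -mulrA ler_pM2l ?subr_gt0// finite_zero_ge.
have wy0 : 0 < w * y by apply: lt_le_trans dwy.
have W0 : 0 < 1 + (w * y) ^+ 2 by rewrite ltr_wpDr ?sqr_ge0.
have sl : w / (1 + (w * y) ^+ 2) <= slope q N y.
  rewrite /slope (bigD1 (Ordinal kN))//= lerDl sumr_ge0// => j _.
  by rewrite divr_ge0 ?weight_ge0// addr_ge0 ?sqr_ge0.
have y20 : 0 < y ^+ 2 by rewrite exprn_gt0//; lra.
apply: (@le_trans _ _ (y ^+ 2 * (w / (1 + (w * y) ^+ 2)))^-1).
  have w'0 : 0 < w / (1 + (w * y) ^+ 2) by rewrite divr_gt0.
  by rewrite lef_pV2 ?posrE ?ler_pM2l// mulr_gt0// (lt_le_trans _ sl).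
have -> : (y ^+ 2 * (w / (1 + (w * y) ^+ 2)))^-1 = w * (1 + (w * y) ^- 2).
  by field; rewrite !gt_eqF// -?exprMn ?exprn_gt0//; lra.
have -> : dominant * (q ^+ 2) ^+ k = w * (1 + d ^- 2).
  by rewrite /dominant /w /weight -exprM mul2n -/d; ring.
rewrite ler_pM2l// lerD2l lef_pV2 ?posrE ?exprn_gt0//.
by apply: lerXn2r; rewrite ?nnegrE ?(ltW d0) ?(ltW wy0).
Qed.

Lemma dominant_cvg : cvgn (series (fun k => dominant * (q ^+ 2) ^+ k)).
Proof.
case/andP: (q01) => q0 q1; apply: is_cvg_geometric_series.
by rewrite ger0_norm ?sqr_ge0// expr_lt1// ltW.
Qed.

Lemma dominant_ge0 : 0 <= dominant.
Proof.
case/andP: (q01) => q0 q1; rewrite mulr_ge0 ?subr_ge0 ?(ltW q1)//.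
by rewrite addr_ge0// invr_ge0 sqr_ge0.
Qed.

Definition finite_zeta (m n : nat) : R :=
  \sum_(k < m) (finite_zero m k ^+ n.*2 * slope q (depth m) (finite_zero m k))^-1.

Definition zeta_term (n k : nat) : R := (zero k ^+ n.*2 * Slope q (zero k))^-1.

(** All zeros are at least 1, so the domination found for exponent 2 serves every exponent [n.*2]
    with [n > 0]. *)
Lemma zeta_cvg n : (0 < n)%N ->
  cvgn (series (zeta_term n)) /\
  finite_zeta ^~ n @ \oo --> limn (series (zeta_term n)).
Proof.
case: n => // n _.
apply: (tannery (T := fun m k =>
  (finite_zero m k ^+ n.+1.*2 * slope q (depth m) (finite_zero m k))^-1)
  _ _ dominant_cvg) => [m k km|k].
  have sl := slope_gt0 q01 (finite_zero m k)
    (depth_gt0 b (leq_ltn_trans (leq0n k) km)).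
  have y1 := finite_zero_ge1 km.
  apply/andP; split.
    by rewrite invr_ge0 mulr_ge0 ?(ltW sl)// exprn_ge0//; lra.
  apply: le_trans (slope_dominated km).
  have yn d : 0 < finite_zero m k ^+ d by rewrite exprn_gt0// (lt_le_trans _ y1).
  rewrite lef_pV2 ?posrE; [|exact: mulr_gt0..].
  by rewrite ler_pM2r//; apply: ler_weXn2l.
have z0 : zero k ^+ n.+1.*2 * Slope q (zero k) != 0.
  rewrite gt_eqF// mulr_gt0 ?Slope_gt0// exprn_gt0//.
  by rewrite (lt_le_trans _ (zero_ge1 k)).
have zn : (fun m => finite_zero m k ^+ n.+1.*2) @ \oo --> zero k ^+ n.+1.*2.
  exact: (cvg_comp _ _ (@finite_zero_cvg k) (@exprn_continuous _ _ _)).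
have h : (fun m => finite_zero m k ^+ n.+1.*2 *
    slope q (depth m) (finite_zero m k)) @ \oo -->
    zero k ^+ n.+1.*2 * Slope q (zero k).
  exact: (cvgM zn (@slope_finite_zero_cvg k)).
exact: (cvgV z0 h).
Qed.

End Zeros.


(** * Complex sequences and products *)

Section ComplexTopology.
Variable R : realType.
Implicit Types (u v : (R[i])^nat) (a b z : R[i]).

Lemma normc_ge0 z : 0 <= normc z.
Proof. by case: z => x y /=; exact: sqrtr_ge0. Qed.

Lemma normc_real (x : R) : normc x%:C = `|x|.
Proof. by rewrite /= expr0n/= addr0 sqrtr_sqr. Qed.

Lemma normc_nat n : normc (n%:R : R[i]) = n%:R.
Proof. by rewrite -(rmorph_nat (real_complex R)) normc_real ger0_norm. Qed.

Lemma normc_i : normc ('i%C : R[i]) = 1.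
Proof. by rewrite /= expr0n/= add0r expr1n sqrtr1. Qed.

Lemma normc_eq0 z : (normc z == 0) = (z == 0).
Proof.
apply/eqP/eqP => [|->]; first exact: ComplexField.Normc.eq0_normc.
by rewrite ComplexField.Normc.normc0.
Qed.

Lemma normc_gt0 z : (0 < normc z) = (z != 0).
Proof. by rewrite lt_def normc_ge0 andbT normc_eq0. Qed.

Lemma normcB a z : normc (a - z) = normc (z - a).
Proof. by rewrite -opprB normcN. Qed.

Lemma normcX z n : normc (z ^+ n) = normc z ^+ n.
Proof.
elim: n => [|n IH]; first by rewrite !expr0 ComplexField.Normc.normc1.
by rewrite !exprS ComplexField.Normc.normcM IH.
Qed.

Lemma normc_sum I (r : seq I) (P : pred I) (F : I -> R[i]) :
  normc (\sum_(i <- r | P i) F i) <= \sum_(i <- r | P i) normc (F i).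
Proof.
elim/big_ind2 : _ => //; first by rewrite ComplexField.Normc.normc0.
by move=> x1 x2 y1 y2 h1 h2; apply: le_trans (le_normcD _ _) _; exact: lerD.
Qed.

Lemma ger0_normc_sub a z : normc a - normc z <= normc (a - z).
Proof. by rewrite lerBlDr -{1}(subrK z a) le_normcD. Qed.

Lemma normc_Re z : `|complex.Re z| <= normc z.
Proof.
by case: z => x y /=; rewrite -sqrtr_sqr ler_sqrt ?addr_ge0 ?sqr_ge0// lerDl sqr_ge0.
Qed.

Lemma normc_Im z : `|complex.Im z| <= normc z.
Proof.
by case: z => x y /=; rewrite -sqrtr_sqr ler_sqrt ?addr_ge0 ?sqr_ge0// lerDr sqr_ge0.
Qed.

(** The norm of [R[i]] takes values in [R[i]], where a positive radius has imaginary part 0; this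
    translates to the real modulus. *)
Lemma cvg_complexP u a :
  u @ \oo --> a <-> (fun n => normc (u n - a)) @ \oo --> 0.
Proof.
split=> [ua|ua].
  apply/cvgrPdist_lt => e e0.
  have/cvgrPdist_lt /(_ e%:C) := ua.
  rewrite ltcR => /(_ e0); apply: filterS => n.
  by rewrite ltcE /= => /andP[_]; rewrite sub0r normrN ger0_norm ?normc_ge0// normcB.
apply/cvgrPdist_lt => e; rewrite ltcE => /= /andP[/eqP im0 e0].
move/cvgrPdist_lt : ua => /(_ _ e0); apply: filterS => n.
rewrite sub0r normrN ger0_norm ?normc_ge0// normcB => ne.
by rewrite ltcE /= im0 eqxx.
Qed.

Lemma cvg_complex_squeeze u a (e : R^nat) :
    (\forall n \near \oo, normc (u n - a) <= e n) -> e @ \oo --> 0 ->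
  u @ \oo --> a.
Proof.
move=> ue e0; apply/cvg_complexP.
apply: (squeeze_cvgr (f := fun=> 0) (h := e)) => //; last exact: cvg_cst.
by apply: filterS ue => n ->; rewrite normc_ge0.
Qed.

Lemma cvg_complexD u v a b :
  u @ \oo --> a -> v @ \oo --> b -> (fun n => u n + v n) @ \oo --> a + b.
Proof. by move=> ua vb; have h := cvgD ua vb; exact: h. Qed.

Lemma cvg_complexB u v a b :
  u @ \oo --> a -> v @ \oo --> b -> (fun n => u n - v n) @ \oo --> a - b.
Proof. by move=> ua vb; have h := cvgB ua vb; exact: h. Qed.

Lemma cvg_complexM u v a b :
  u @ \oo --> a -> v @ \oo --> b -> (fun n => u n * v n) @ \oo --> a * b.
Proof. by move=> ua vb; have h := cvgM ua vb; exact: h. Qed.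

Lemma cvg_complex_cst a : (fun=> a) @ \oo --> a.
Proof. by have h := cvg_cst a; exact: h. Qed.

Lemma cvg_complexMl u a b : u @ \oo --> a -> (fun n => b * u n) @ \oo --> b * a.
Proof. by move=> ua; apply: cvg_complexM ua; exact: cvg_complex_cst. Qed.

Lemma cvg_normc u a : u @ \oo --> a -> (fun n => normc (u n)) @ \oo --> normc a.
Proof.
move/cvg_complexP => ua; apply/cvgrPdist_lt => e e0.
move/cvgrPdist_lt : ua => /(_ _ e0); apply: filterS => n.
rewrite sub0r normrN ger0_norm ?normc_ge0//; apply: le_lt_trans.
rewrite ler_norml lerNl opprB ger0_normc_sub normcB.
exact: ger0_normc_sub.
Qed.

Lemma cvg_complex_ReIm u (x y : R) :
    (fun n => complex.Re (u n)) @ \oo --> x ->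
    (fun n => complex.Im (u n)) @ \oo --> y ->
  u @ \oo --> (x +i* y).
Proof.
move=> ux uy.
have h : (fun n => `|complex.Re (u n) - x| + `|complex.Im (u n) - y|) @ \oo -->
    `|x - x| + `|y - y|.
  exact: (cvgD (cvg_norm (cvgB ux (cvg_cst x))) (cvg_norm (cvgB uy (cvg_cst y)))).
rewrite !subrr normr0 addr0 in h.
apply: (cvg_complex_squeeze _ h); near=> n.
case: (u n) => p r.
have -> : (p +i* r) - (x +i* y) = (p - x)%:C + 'i%C * (r - y)%:C.
  by apply/eqP; rewrite eq_complex/=; apply/andP; split; apply/eqP; ring.
apply: le_trans (le_normcD _ _) _.
by rewrite ComplexField.Normc.normcM normc_i mul1r !normc_real.
Unshelve. all: by end_near. Qed.

Lemma cvg_real_complex (u : R^nat) (x : R) :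
  u @ \oo --> x -> (fun n => (u n)%:C) @ \oo --> x%:C.
Proof. by move=> ux; apply: cvg_complex_ReIm => //; exact: cvg_cst. Qed.

Lemma cvg_complex_unique u a z : u @ \oo --> a -> u @ \oo --> z -> a = z.
Proof. by move=> ua uz; have := cvg_lim (@norm_hausdorff _ _) ua;
  have := cvg_lim (@norm_hausdorff _ _) uz => <- <-. Qed.

Lemma cvg_series_complex u (v : R^nat) :
    (forall n, normc (u n) <= v n) -> cvgn (series v) ->
  exists l : R[i], series u @ \oo --> l.
Proof.
move=> uv vcvg.
have real_cvg (f : R[i] -> R) : (forall z, `|f z| <= normc z) ->
    cvgn (series (fun n => f (u n))).
  move=> fle; apply: normed_cvg; apply: series_le_cvg vcvg => n.
  - exact: normr_ge0.
  - exact: le_trans (normc_ge0 _) (uv n).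
  - by apply: le_trans (uv n); exact: fle.
have cRe := real_cvg _ normc_Re; have cIm := real_cvg _ normc_Im.
exists (limn (series (fun n => complex.Re (u n))) +i*
        limn (series (fun n => complex.Im (u n)))).
apply: cvg_complex_ReIm.
  have -> // : (fun n => complex.Re (series u n)) = series (fun n => complex.Re (u n)).
  apply/funext => n; rewrite /series/=.
  by elim/big_rec2: _ => [//|k x z _ <-]; case: (u k); case: z.
have -> // : (fun n => complex.Im (series u n)) = series (fun n => complex.Im (u n)).
apply/funext => n; rewrite /series/=.
by elim/big_rec2: _ => [//|k x z _ <-]; case: (u k); case: z.
Qed.

End ComplexTopology.

Section Products.
Variable R : realType.
Implicit Types (y : nat -> R[i]) (N : nat).

Lemma normc_prod_le y N :
  normc (\prod_(j < N) (1 + y j)) <= expR (\sum_(j < N) normc (y j)).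
Proof.
elim: N => [|N IH]; first by rewrite !big_ord0 ComplexField.Normc.normc1 expR0.
rewrite !big_ord_recr/= ComplexField.Normc.normcM expRD.
apply: ler_pM; rewrite ?normc_ge0//.
apply: le_trans (le_normcD _ _) _; rewrite ComplexField.Normc.normc1.
exact: expR_ge1Dx.
Qed.

(** A second-order remainder independent of N: a new factor changes the error by [(P - 1) * y N], at
    most [2 * s * c], the cross term of [(s + c) ^+ 2]. The derivative of the infinite product rests
    on this. *)
Lemma prod_linear_approx y N : \sum_(j < N) normc (y j) <= 1 ->
  normc (\prod_(j < N) (1 + y j) - 1 - \sum_(j < N) y j) <=
    (\sum_(j < N) normc (y j)) ^+ 2.
Proof.
elim: N => [|N IH].
  by rewrite !big_ord0 subrr subr0 ComplexField.Normc.normc0 expr0n.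
rewrite !big_ord_recr/=.
set s := \sum_(j < N) normc (y j); set P := \prod_(j < N) _.
set L := \sum_(j < N) y j; set c := normc (y N) => sc1.
have c0 : 0 <= c := normc_ge0 _.
have s0 : 0 <= s by apply: sumr_ge0 => j _; exact: normc_ge0.
have {}IH : normc (P - 1 - L) <= s ^+ 2 by apply: IH; rewrite -/s; lra.
have P1 : normc (P - 1) <= 2 * s.
  rewrite -(subrK L (P - 1)); apply: le_trans (le_normcD _ _) _.
  have : normc L <= s by exact: normc_sum.
  by nra.
have -> : P * (1 + y N) - 1 - (L + y N) = (P - 1 - L) + (P - 1) * y N by ring.
apply: le_trans (le_normcD _ _) _; rewrite ComplexField.Normc.normcM -/c.
have := ler_wpM2r c0 P1; nra.
Qed.

Lemma prod_sub1_le y N : \sum_(j < N) normc (y j) <= 1 ->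
  normc (\prod_(j < N) (1 + y j) - 1) <= 2 * \sum_(j < N) normc (y j).
Proof.
move=> s1; have := prod_linear_approx s1.
set s := \sum_(j < N) normc (y j) in s1 *; set L := \sum_(j < N) y j => h.
rewrite -(subrK L (_ - 1)); apply: le_trans (le_normcD _ _) _.
have Ls : normc L <= s by exact: normc_sum.
have s0 : 0 <= s by apply: sumr_ge0 => j _; exact: normc_ge0.
by nra.
Qed.

End Products.

Arguments cvg_complex_cst {R} a.

(** * The products E_q(iz): convergence, polar form and linear approximation *)

Section Factors.
Variables (R : realType) (q : R).
Hypothesis q01 : 0 < q < 1.
Implicit Types (z h : R[i]) (x : R).

Definition iweight (j : nat) : R[i] := 'i%C * (weight q j)%:C.

(* Truncation of the product [E_q ('i%C * z)]. *)
Definition trunc_E (N : nat) z : R[i] := \prod_(j < N) (1 + iweight j * z).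

Definition lim_E z : R[i] := E_q q ('i%C * z).

Lemma normc_iweight j : normc (iweight j) = weight q j.
Proof.
by rewrite ComplexField.Normc.normcM normc_i mul1r normc_real ger0_norm// weight_ge0.
Qed.

Lemma sum_normc_iweight N z : \sum_(j < N) normc (iweight j * z) <= normc z.
Proof.
under eq_bigr do rewrite ComplexField.Normc.normcM normc_iweight.
by rewrite -mulr_suml ler_piMl ?normc_ge0// sum_weight_le1.
Qed.

Lemma normc_trunc_E N z : normc (trunc_E N z) <= expR (normc z).
Proof.
apply: le_trans (normc_prod_le (fun j => iweight j * z) N) _.
by rewrite ler_expR sum_normc_iweight.
Qed.

(** Consecutive truncations differ by a uniformly bounded product times a weight times [z], and the
    weights are geometric. *)
Lemma trunc_E_cvg_ex z : exists l : R[i], trunc_E ^~ z @ \oo --> l.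
Proof.
pose u k := trunc_E k.+1 z - trunc_E k z.
have [k||l ul] := @cvg_series_complex _ u
    (fun k => (expR (normc z) * normc z * (1 - q)) * q ^+ k); first last.
- exists (l + 1).
  have -> : trunc_E ^~ z = (fun n => series u n + 1).
    apply/funext => n; rewrite /series/= telescope_sumr//.
    by rewrite {3}/trunc_E big_ord0 subrK.
  exact: (cvg_complexD ul (cvg_complex_cst 1)).
- case/andP: (q01) => q0 q1; apply: is_cvg_geometric_series.
  by rewrite ger0_norm ?ltW.
have -> : u k = trunc_E k z * (iweight k * z).
  by rewrite /u {1}/trunc_E big_ord_recr/= -/(trunc_E k z); ring.
rewrite 2!ComplexField.Normc.normcM normc_iweight.
have -> : expR (normc z) * normc z * (1 - q) * q ^+ k =
  expR (normc z) * (weight q k * normc z) by rewrite /weight; ring.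
by rewrite ler_wpM2r ?normc_trunc_E// mulr_ge0 ?normc_ge0 ?weight_ge0.
Qed.

Lemma qpochhammer_lim_E z : qpochhammer q (- ((1 - q%:C) * ('i%C * z))) = lim_E z.
Proof. by rewrite /lim_E /E_q mulNr. Qed.

Lemma trunc_E_cvg z : trunc_E ^~ z @ \oo --> lim_E z.
Proof.
have [l zl] := trunc_E_cvg_ex z.
rewrite -qpochhammer_lim_E /qpochhammer.
have -> : (fun n => \prod_(0 <= j < n) (1 - - ((1 - q%:C) * ('i%C * z)) * q%:C ^+ j))
    = trunc_E ^~ z.
  apply/funext => n; rewrite big_mkord; apply: eq_bigr => j _.
  rewrite mulNr opprK /iweight /weight rmorphM/= rmorphB/= rmorphXn/=.
  by congr (1 + _); ring.
by rewrite (cvg_lim (@norm_hausdorff _ _) zl).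
Qed.

Lemma lim_E_near1 z : normc z <= 1 -> normc (lim_E z - 1) <= 2 * normc z.
Proof.
move=> z1; apply: (cvgr_to_le (F := \oo) (f := fun n => normc (trunc_E n z - 1))).
  by apply: cvg_normc; exact: (cvg_complexB (@trunc_E_cvg z) (cvg_complex_cst 1)).
near=> n; apply: le_trans (prod_sub1_le (y := fun j => iweight j * z) _) _.
  exact: le_trans (sum_normc_iweight _ _) z1.
by rewrite ler_wpM2l// sum_normc_iweight.
Unshelve. all: by end_near. Qed.

Lemma lim_E_neq0 z : normc z <= 1 / 4 -> lim_E z != 0.
Proof.
move=> z4; apply/eqP => E0; have := @lim_E_near1 z.
rewrite E0 sub0r normcN ComplexField.Normc.normc1; lra.
Qed.

Definition modulus (N : nat) x : R := \prod_(j < N) Num.sqrt (1 + (weight q j * x) ^+ 2).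

Lemma modulus_ge1 N x : 1 <= modulus N x.
Proof.
rewrite /modulus; elim/big_ind: _ => // [u v u1 v1|j _].
  by rewrite -[1]mulr1 ler_pM.
by rewrite -{1}sqrtr1 ler_wsqrtr// lerDl sqr_ge0.
Qed.

Lemma modulusN N x : modulus N (- x) = modulus N x.
Proof. by apply: eq_bigr => j _; rewrite mulrN sqrrN. Qed.

(** Each factor has real part 1, so its argument is an arctangent and the arguments add up to the
    phase without a choice of branch. *)
Lemma trunc_E_polar N x :
  trunc_E N x%:C =
    (modulus N x)%:C * (cos (phase q N x) +i* sin (phase q N x)).
Proof.
rewrite /trunc_E /modulus /phase; elim: N => [|N IH].
  by rewrite !big_ord0 cos0 sin0 mul1r.
rewrite !big_ord_recr/= IH cosD sinD rmorphM/=.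
set c := cos (\sum_(_ < _) _); set s := sin (\sum_(_ < _) _).
set a := weight q N * x; set r := Num.sqrt _.
have r0 : r != 0 by rewrite sqrtr_eq0 -ltNge ltr_wpDr ?sqr_ge0.
have ca : cos (atan a) = r^-1 by rewrite cos_atan.
have sa : sin (atan a) = a / r by rewrite sin_atan ca.
have -> : 1 + iweight N * x%:C = (r * r^-1)%:C * (1 +i* a).
  rewrite divff// mul1r /iweight -mulrA -rmorphM/= -/a.
  by apply/eqP; rewrite eq_complex/=; apply/andP; split; apply/eqP; ring.
rewrite ca sa; set m := \prod_(_ < _) _.
by apply/eqP; rewrite eq_complex/=; apply/andP; split; apply/eqP; ring.
Qed.

Definition logder N x : R[i] := \sum_(j < N) iweight j / (1 + iweight j * x%:C).

Lemma iweight_real_neq0 j x : 1 + iweight j * x%:C != 0.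
Proof.
rewrite eq_complex negb_and /=; apply/orP; left.
by rewrite !(mul0r, mulr0, subr0, add0r, addr0, mul1r, oppr0) oner_neq0.
Qed.

Definition slope_re N x : R :=
  \sum_(j < N) weight q j * (weight q j * x) / (1 + (weight q j * x) ^+ 2).

(** The imaginary part is the derivative of the argument, the real part that of the logarithm of the
    modulus. *)
Lemma logderE N x : logder N x = (slope_re N x)%:C + 'i%C * (slope q N x)%:C.
Proof.
rewrite /logder /slope_re /slope !rmorph_sum/= mulr_sumr -big_split/=.
apply: eq_bigr => j _; set w := weight q j.
have nz := iweight_real_neq0 j x.
have W0 : 1 + (w * x) ^+ 2 != 0 by rewrite gt_eqF// ltr_wpDr ?sqr_ge0.
apply: (mulIf nz); rewrite mulfVK// /iweight -/w.
by apply/eqP; rewrite eq_complex/=; apply/andP; split; apply/eqP; field.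
Qed.

Lemma slope_reN N x : slope_re N (- x) = - slope_re N x.
Proof.
by rewrite /slope_re -sumrN; apply: eq_bigr => j _; rewrite mulrN sqrrN mulrN mulNr.
Qed.

Lemma slope_re_le1 N x : `|slope_re N x| <= 1.
Proof.
apply: le_trans (ler_norm_sum _ _ _) _; apply: le_trans (sum_weight_le1 q01 N).
apply: ler_sum => j _; set w := weight q j; have w0 : 0 <= w := weight_ge0 q01 j.
have W0 : 0 < 1 + (w * x) ^+ 2 by rewrite ltr_wpDr ?sqr_ge0.
rewrite -mulrA normrM (ger0_norm w0) ler_piMr// normrM normfV (gtr0_norm W0).
rewrite ler_pdivrMr// mul1r ler_norml.
by have := sqr_ge0 (w * x - 1); have := sqr_ge0 (w * x + 1);
  have := sqr_ge0 (w * x); lra.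
Qed.

Lemma normc_one_iweight_ge1 j x : 1 <= normc (1 + iweight j * x%:C).
Proof.
apply: le_trans (normc_Re _); rewrite /= !(mul0r, mulr0, subr0, add0r, addr0, mul1r, oppr0).
by rewrite normr1.
Qed.

(** Each factor at [x + h] is its value at [x] times [1 + y j]. At real [x] that value has modulus
    at least 1, so the [y j] sum to at most [normc h] in modulus and [prod_linear_approx] applies.
    The constant does not involve N, so the estimate survives the limit. *)
Lemma trunc_E_linear_approx N x h : normc h <= 1 ->
  normc (trunc_E N (x%:C + h) - trunc_E N x%:C * (1 + h * logder N x)) <=
    expR `|x| * normc h ^+ 2.
Proof.
move=> h1; pose y j := iweight j / (1 + iweight j * x%:C) * h.
have yle j : normc (y j) <= normc (iweight j * h).
  rewrite /y ComplexField.Normc.normcM [leRHS]ComplexField.Normc.normcM.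
  rewrite ler_wpM2r ?normc_ge0// ComplexField.Normc.normcM.
  rewrite ComplexField.Normc.normcV ler_piMr ?normc_ge0//.
  by rewrite invf_le1 ?(lt_le_trans _ (normc_one_iweight_ge1 j x))// normc_one_iweight_ge1.
have sy : \sum_(j < N) normc (y j) <= normc h.
  by apply: le_trans (sum_normc_iweight N h); apply: ler_sum.
have -> : trunc_E N (x%:C + h) = trunc_E N x%:C * \prod_(j < N) (1 + y j).
  rewrite /trunc_E -big_split/=; apply: eq_bigr => j _.
  by rewrite /y; field; exact: iweight_real_neq0.
have -> : h * logder N x = \sum_(j < N) y j by rewrite mulrC mulr_suml.
rewrite -mulrBr opprD addrA ComplexField.Normc.normcM.
apply: ler_pM; rewrite ?normc_ge0//.
  by rewrite -normc_real normc_trunc_E.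
apply: le_trans (prod_linear_approx (le_trans sy h1)) _.
rewrite lerXn2r ?nnegrE ?normc_ge0//.
by apply: sumr_ge0 => j _; exact: normc_ge0.
Qed.

End Factors.

(** * The q-cotangent and the q-tangent *)

Section Quotient.
Variables (R : realType) (q : R) (b : bool).
Hypothesis q01 : 0 < q < 1.
Implicit Types (z h : R[i]) (x : R).

(** This is - exp(- i alpha). For the products at hand E(-x) is the conjugate of E(x) at real x, so
    [num_of] and [den_of] are there the real and imaginary parts of [rot * E x]. *)
Definition rot : R[i] := if b then 1 else 'i%C.

(* For [E z = E_q ('i%C * z)], [num_of E / den_of E] is [Cos_q / Sin_q] when
   [b = true] and [- Sin_q / Cos_q] when [b = false]. *)
Definition num_of (E : R[i] -> R[i]) z : R[i] :=
  (rot * E z + rot^-1 * E (- z)) / 2.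

Definition den_of (E : R[i] -> R[i]) z : R[i] :=
  (rot * E z - rot^-1 * E (- z)) / (2 * 'i%C).

Local Notation num N := (num_of (trunc_E q N)).
Local Notation den N := (den_of (trunc_E q N)).
Local Notation Num := (num_of (lim_E q)).
Local Notation Den := (den_of (lim_E q)).

Lemma i_neq0 : 'i%C != 0 :> R[i].
Proof. by rewrite eq_complex/= oner_eq0 andbF. Qed.

Lemma invi : ('i%C : R[i])^-1 = - 'i%C.
Proof.
apply: (mulfI i_neq0); rewrite divff ?i_neq0// mulrN.
by apply/eqP; rewrite eq_complex/=; apply/andP; split; apply/eqP; ring.
Qed.

Lemma normc_rot : normc rot = 1.
Proof. by rewrite /rot; case: b; rewrite ?normc_i// ComplexField.Normc.normc1. Qed.

Lemma rot_neq0 : rot != 0.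
Proof. by rewrite -normc_gt0 normc_rot. Qed.

Lemma num_cvg z : (fun N => num N z) @ \oo --> Num z.
Proof.
apply: cvg_complexM; last exact: cvg_complex_cst.
by apply: cvg_complexD; apply: cvg_complexMl; exact: trunc_E_cvg.
Qed.

Lemma den_cvg z : (fun N => den N z) @ \oo --> Den z.
Proof.
apply: cvg_complexM; last exact: cvg_complex_cst.
by apply: cvg_complexB; apply: cvg_complexMl; exact: trunc_E_cvg.
Qed.

Lemma den_real N x :
  den N x%:C = (- (modulus q N x * sin (phase q N x - alpha R b)))%:C.
Proof.
rewrite /den_of -rmorphN/= !trunc_E_polar phaseN modulusN cosN sinN.
set c := cos _; set s := sin _; set m := modulus _ _ _.
have h : 2 * 'i%C != 0 :> R[i] by rewrite mulf_neq0 ?i_neq0// pnatr_eq0.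
apply: (mulIf h); rewrite mulfVK// /rot /alpha; case: b.
  rewrite invr1 sinB cospi sinpi -/c -/s.
  by apply/eqP; rewrite eq_complex/=; apply/andP; split; apply/eqP; ring.
rewrite invi sinBpihalf -/c.
by apply/eqP; rewrite eq_complex/=; apply/andP; split; apply/eqP; ring.
Qed.

Lemma num_real N x :
  num N x%:C = (- (modulus q N x * cos (phase q N x - alpha R b)))%:C.
Proof.
rewrite /num_of -rmorphN/= !trunc_E_polar phaseN modulusN cosN sinN.
set c := cos _; set s := sin _; set m := modulus _ _ _.
have h : 2 != 0 :> R[i] by rewrite pnatr_eq0.
apply: (mulIf h); rewrite mulfVK// /rot /alpha; case: b.
  rewrite invr1 cosB cospi sinpi -/c -/s.
  by apply/eqP; rewrite eq_complex/=; apply/andP; split; apply/eqP; ring.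
rewrite invi cosBpihalf -/s.
by apply/eqP; rewrite eq_complex/=; apply/andP; split; apply/eqP; ring.
Qed.

(** [M] is the modulus of E_q(ix). Being at least 1, it can be divided out: the zeros of [Den] are
    those of a sine, and [Num] cannot vanish there. *)
Lemma Den_Num_real x : 0 <= x -> exists M, 1 <= M /\
  Den x%:C = (- (M * sin (Phase q x - alpha R b)))%:C /\
  Num x%:C = (- (M * cos (Phase q x - alpha R b)))%:C.
Proof.
move=> x0; exists (normc (lim_E q x%:C)).
have mc : (fun N => modulus q N x) @ \oo --> normc (lim_E q x%:C).
  have := cvg_normc (@trunc_E_cvg _ _ q01 x%:C).
  under eq_fun => N.
    rewrite trunc_E_polar ComplexField.Normc.normcM normc_real/=.
    rewrite cos2Dsin2 sqrtr1 mulr1 ger0_norm ?(le_trans _ (modulus_ge1 q N x))//.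
    over.
  by [].
have pc : (fun N => phase q N x - alpha R b) @ \oo --> Phase q x - alpha R b.
  by have h := cvgB (phase_cvg q01 x0) (cvg_cst (alpha R b)); exact: h.
split.
  by apply: (cvgr_to_ge mc); exists 0%N => // N _; exact: modulus_ge1.
split.
  apply: (cvg_complex_unique (@den_cvg x%:C)).
  under eq_fun do rewrite den_real.
  apply: cvg_real_complex; apply: cvgN; apply: (cvgM mc).
  exact: (cvg_comp _ _ pc (@continuous_sin _ _)).
apply: (cvg_complex_unique (@num_cvg x%:C)).
under eq_fun do rewrite num_real.
apply: cvg_real_complex; apply: cvgN; apply: (cvgM mc).
exact: (cvg_comp _ _ pc (@continuous_cos _ _)).
Qed.

Lemma sin_natpi k : sin (k%:R * pi) = 0 :> R.
Proof.
elim: k => [|k IH]; first by rewrite mul0r sin0.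
by rewrite -natr1 mulrDl mul1r sinDpi IH oppr0.
Qed.

Lemma cos_natpi_neq0 k : cos (k%:R * pi) != 0 :> R.
Proof.
elim: k => [|k IH]; first by rewrite mul0r cos0 oner_neq0.
by rewrite -natr1 mulrDl mul1r cosDpi oppr_eq0.
Qed.

Lemma Den_zero k : Den (zero q b k)%:C = 0.
Proof.
have [M [_ [-> _]]] := Den_Num_real (zero_ge0 b q01 k).
by rewrite Phase_zero// /angle addrK sin_natpi mulr0 oppr0.
Qed.

Lemma Num_zero_neq0 k : Num (zero q b k)%:C != 0.
Proof.
have [M [M1 [_ ->]]] := Den_Num_real (zero_ge0 b q01 k).
rewrite Phase_zero// /angle addrK -(rmorph0 (real_complex R)).
rewrite (inj_eq (@complexI R)) oppr_eq0 mulf_neq0 ?cos_natpi_neq0//.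
by rewrite gt_eqF// (lt_le_trans _ M1).
Qed.

Lemma zero_enumerates : enumerates_positive_zeros Den (zero q b).
Proof.
split=> [m n|]; first by rewrite !leNgt zero_lt// -leqNgt.
apply/seteqP; split=> [_ [k _ <-]|x [x0 Dx]] /=.
  by split; [exact: lt_le_trans (zero_ge1 b q01 k)|exact: Den_zero].
have [M [M1 [Dx' _]]] := Den_Num_real (ltW x0).
move: Dx; rewrite Dx' => -[/eqP]; rewrite oppr_eq0 mulf_eq0 gt_eqF ?(lt_le_trans _ M1)//=.
by move=> /eqP /(zero_onto q01 x0)[k <-]; exists k.
Qed.

(** The derivative of [den N] at [x] is [slope * num + slope_re * den]. The second part is counted
    as error: [x] will be a zero of the limit, not of the truncation, and [normc (den N x%:C)] then
    tends to 0. *)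
Lemma den_linear_approx N x h : normc h <= 1 ->
  normc (den N (x%:C + h) - den N x%:C - h * (slope q N x)%:C * num N x%:C) <=
    expR `|x| * normc h ^+ 2 + normc (den N x%:C).
Proof.
move=> h1.
have a1 := trunc_E_linear_approx q01 N x h1.
have a2 : normc (trunc_E q N (- (x%:C + h)) - trunc_E q N (- x)%:C *
    (1 + - h * logder q N (- x))) <= expR `|x| * normc h ^+ 2.
  rewrite opprD -rmorphN/= -(normrN x) -(normcN h).
  by apply: trunc_E_linear_approx; rewrite ?normcN.
rewrite logderE in a1; rewrite logderE slope_reN slopeN in a2.
set e1 := (X in normc X) in a1; set e2 := (X in normc X) in a2.
set G := slope_re q N x in e1 e2 a1 a2; set F := slope q N x in e1 e2 a1 a2 *.
have -> : den N (x%:C + h) - den N x%:C - h * F%:C * num N x%:C =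
    (rot * e1 - rot^-1 * e2) / (2 * 'i%C) + h * (G%:C * den N x%:C).
  rewrite /den_of /num_of /e1 /e2 rmorphN/=.
  by field; rewrite rot_neq0 i_neq0.
apply: le_trans (le_normcD _ _) _; apply: lerD.
  rewrite ComplexField.Normc.normcM ComplexField.Normc.normcV.
  rewrite ComplexField.Normc.normcM normc_i mulr1.
  rewrite normc_nat.
  rewrite ler_pdivrMr//; apply: le_trans (le_normcD _ _) _.
  rewrite normcN !ComplexField.Normc.normcM ComplexField.Normc.normcV normc_rot invr1.
  by rewrite !mul1r; lra.
rewrite ComplexField.Normc.normcM [X in _ * X]ComplexField.Normc.normcM normc_real.
rewrite mulrA ler_piMl ?normc_ge0//.
by rewrite mulr_ile1 ?normc_ge0// slope_re_le1.
Qed.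

Lemma Den_linear_approx x h : 0 <= x -> Den x%:C = 0 -> normc h <= 1 ->
  normc (Den (x%:C + h) - h * (Slope q x)%:C * Num x%:C) <= expR `|x| * normc h ^+ 2.
Proof.
move=> x0 Dx h1; rewrite -[Den (x%:C + h)]subr0 -Dx.
rewrite -[leRHS]addr0 -[in leRHS](ComplexField.Normc.normc0 R) -[in leRHS]Dx.
have sl := cvg_real_complex (@slope_cvg _ _ q01 x).
have c1 := cvg_normc (cvg_complexB (cvg_complexB (@den_cvg (x%:C + h)) (@den_cvg x%:C))
   (cvg_complexM (cvg_complexMl (b := h) sl) (@num_cvg x%:C))).
have c2 : (fun N => expR `|x| * normc h ^+ 2 + normc (den N x%:C)) @ \oo -->
    expR `|x| * normc h ^+ 2 + normc (Den x%:C).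
  by apply: cvgD; [exact: cvg_cst|apply: cvg_normc; exact: den_cvg].
apply: (ler_cvg_to c1 c2); exists 0%N => // N _ /=.
exact: den_linear_approx.
Qed.

Lemma derive1_Den k :
  derive1 Den (zero q b k)%:C = (Slope q (zero q b k))%:C * Num (zero q b k)%:C.
Proof.
set x := zero q b k; have x0 : 0 <= x := zero_ge0 b q01 k.
rewrite /derive1; apply: (cvg_lim (@norm_hausdorff _ _)).
apply/cvgrPdist_lt => e; rewrite ltcE => /= /andP[/eqP im0 e0].
set K := expR `|x|; have K0 : 0 < K := expR_gt0 _.
(* The bound 1 allows the linear estimate; the other makes its error [K * normc h ^+ 2], once
   divided by [normc h], smaller than [e]. *)
pose d := Num.min 1 (complex.Re e / K).
have d0 : 0 < d by rewrite lt_min ltr01 divr_gt0.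
exists d%:C; rewrite /= ?ltcR// => h /=.
rewrite sub0r normrN => hd hn0.
have {hd} hd : normc h < d by move: hd; rewrite ltcE/= => /andP[].
have h1 : normc h <= 1 by apply/ltW/(lt_le_trans hd); rewrite ge_min lexx.
have hK : normc h * K < complex.Re e.
  by rewrite -ltr_pdivlMr//; apply: lt_le_trans hd _; rewrite ge_min lexx orbT.
have hpos : 0 < normc h by rewrite normc_gt0.
have := Den_linear_approx x0 (Den_zero k) h1; rewrite -/x -/K => le1.
rewrite (Den_zero k) subr0 ltcE /= im0 eqxx /= -[ltLHS]normcB.
have -> : h^-1 *: Den (h + x%:C) - (Slope q x)%:C * Num x%:C =
    h^-1 * (Den (x%:C + h) - h * (Slope q x)%:C * Num x%:C).
  by rewrite mulrBr -[h * _ * _]mulrA mulKf// [x%:C + h]addrC.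
rewrite ComplexField.Normc.normcM ComplexField.Normc.normcV.
rewrite mulrC ltr_pdivrMr//; apply: le_lt_trans le1 _.
by rewrite expr2 mulrCA mulrC ltr_pM2r// mulrC.
Qed.

End Quotient.

(** * Partial fractions of the truncations *)

Section PartialFractions.
Variable F : fieldType.

(** Lagrange interpolation: S / (X - r) vanishes at the other roots and takes the value S'(r) at r,
    so the difference [Q] has more roots than its degree permits. *)
Lemma partial_fractions (S C : {poly F}) (rs : seq F) (z : F) :
    uniq rs -> {in rs, forall r, root S r} ->
    {in rs, forall r, S^`().[r] != 0} ->
    (size S <= (size rs).+1)%N -> (size C <= size rs)%N -> z \notin rs ->
  C.[z] = S.[z] * \sum_(r <- rs) (C.[r] / S^`().[r]) / (z - r).
Proof.
move=> urs rootS S'0 sS sC zrs.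
pose T r := S %/ ('X - r%:P).
have TS r : r \in rs -> S = T r * ('X - r%:P).
  by move=> rrs; rewrite divpK// dvdp_XsubCl; exact: rootS.
have Tdiag r : r \in rs -> (T r).[r] = S^`().[r].
  move=> rrs; rewrite [in RHS](TS _ rrs) derivM derivXsubC mulr1 !hornerE.
  by rewrite subrr mulr0 add0r.
have Toff r r' : r \in rs -> r' \in rs -> r' != r -> (T r).[r'] = 0.
  move=> rrs r'rs r'r; have := rootS _ r'rs; rewrite {1}(TS _ rrs) /root !hornerE.
  by rewrite mulf_eq0 [r' - r == 0]subr_eq0 (negbTE r'r) orbF => /eqP.
pose Q := C - \sum_(r <- rs) (C.[r] / S^`().[r]) *: T r.
have Q0 : Q = 0.
  apply: (roots_geq_poly_eq0 (rs := rs)) => //.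
  - apply/allP => r rrs; rewrite /root !hornerE horner_sum (bigD1_seq r)//=.
    rewrite hornerZ Tdiag// divfK ?S'0// big1_seq ?addr0 ?subrr// => r' /andP[r'r r'rs].
    by rewrite hornerZ Toff ?mulr0// eq_sym.
  - apply: leq_trans (size_polyD _ _) _; rewrite geq_max sC size_polyN/=.
    rewrite big_seq; apply: leq_trans (size_sum _ _ _) _.
    apply/bigmax_leqP_seq => r rrs _; apply: leq_trans (size_scale_leq _ _) _.
    rewrite size_divp ?polyXsubC_eq0// size_XsubC/=.
    by rewrite leq_subLR add1n.
have := congr1 (fun p => p.[z]) Q0; rewrite /Q !hornerE horner_sum.
move/eqP; rewrite subr_eq0 => /eqP ->.
rewrite mulr_sumr big_seq [RHS]big_seq; apply: eq_bigr => r rrs.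
have zr : z - r != 0 by rewrite subr_eq0; apply: contraNneq zrs => ->.
have Sz : S.[z] = (T r).[z] * (z - r) by rewrite [in LHS](TS _ rrs) !hornerE.
by rewrite hornerZ Sz; field; rewrite zr S'0.
Qed.

Lemma size_prod_linear (c : nat -> F) N :
  (size (\prod_(j < N) (1 + c j *: 'X))%R <= N.+1)%N.
Proof.
elim: N => [|N IH]; first by rewrite big_ord0 size_poly1.
rewrite big_ord_recr/=; apply: leq_trans (size_polyMleq _ _) _.
have h : (size (1 + c N *: 'X : {poly F})%R <= 2)%N.
  apply: leq_trans (size_polyD _ _) _; rewrite geq_max size_poly1/=.
  by apply: leq_trans (size_scale_leq _ _) _; rewrite size_polyX.
apply: (@leq_trans (N.+1 + 2).-1); last by rewrite addn2.
by rewrite -!subn1 leq_sub2r// leq_add.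
Qed.

Lemma coef_prod_linear (c : nat -> F) N :
  (\prod_(j < N) (1 + c j *: 'X))`_N = \prod_(j < N) c j.
Proof.
elim: N => [|N IH]; first by rewrite !big_ord0 coef1.
rewrite !big_ord_recr/= mulrDr mulr1 -scalerAr coefD coefZ coefMX/= IH.
by rewrite nth_default ?add0r 1?mulrC// size_prod_linear.
Qed.

Lemma deriv_prod_linear (c : nat -> F) N x : (forall j, 1 + c j * x != 0) ->
  ((\prod_(j < N) (1 + c j *: 'X))^`()).[x] =
  (\prod_(j < N) (1 + c j * x)) * \sum_(j < N) c j / (1 + c j * x).
Proof.
move=> nz; elim: N => [|N IH].
  by rewrite !big_ord0 derivC horner0 mulr0.
rewrite !big_ord_recr/= derivM derivD derivC add0r derivZ derivX !hornerE IH.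
have -> : (\prod_(j < N) (1 + c j *: 'X)).[x] = \prod_(j < N) (1 + c j * x).
  by rewrite horner_prod; apply: eq_bigr => j _; rewrite !hornerE.
by rewrite /=; field; exact: nz.
Qed.

End PartialFractions.

Section FiniteExpansion.
Variables (R : realType) (q : R) (b : bool).
Hypothesis q01 : 0 < q < 1.
Implicit Types (z h : R[i]) (x : R).

Local Notation num N := (num_of b (trunc_E q N)).
Local Notation den N := (den_of b (trunc_E q N)).

Definition poly_E (s : R[i]) N : {poly R[i]} :=
  \prod_(j < N) (1 + (s * (weight q j)%:C) *: 'X).

Definition num_poly N : {poly R[i]} :=
  2^-1 *: (rot R b *: poly_E 'i%C N + (rot R b)^-1 *: poly_E (- 'i%C) N).

Definition den_poly N : {poly R[i]} :=
  (2 * 'i%C)^-1 *: (rot R b *: poly_E 'i%C N - (rot R b)^-1 *: poly_E (- 'i%C) N).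

Lemma poly_Ei N z : (poly_E 'i%C N).[z] = trunc_E q N z.
Proof. by rewrite horner_prod; apply: eq_bigr => j _; rewrite !hornerE. Qed.

Lemma poly_ENi N z : (poly_E (- 'i%C) N).[z] = trunc_E q N (- z).
Proof.
rewrite horner_prod; apply: eq_bigr => j _.
by rewrite !hornerE /iweight mulrN !mulNr.
Qed.

Lemma horner_num_poly N z : (num_poly N).[z] = num N z.
Proof.
by rewrite /num_poly hornerZ hornerD !hornerZ poly_Ei poly_ENi mulrC.
Qed.

Lemma horner_den_poly N z : (den_poly N).[z] = den N z.
Proof.
by rewrite /den_poly hornerZ hornerD hornerN !hornerZ poly_Ei poly_ENi mulrC.
Qed.

Lemma size_poly_E s N : (size (poly_E s N) <= N.+1)%N.
Proof. exact: (size_prod_linear (fun j => s * (weight q j)%:C)). Qed.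

Lemma coef_poly_E s N : (poly_E s N)`_N = s ^+ N * \prod_(j < N) (weight q j)%:C.
Proof.
rewrite /poly_E (coef_prod_linear (fun j => s * (weight q j)%:C)).
by rewrite big_split/= prodr_const card_ord.
Qed.

Lemma size_den_poly N : (size (den_poly N) <= N.+1)%N.
Proof.
apply: leq_trans (size_scale_leq _ _) _; apply: leq_trans (size_polyD _ _) _.
rewrite geq_max size_polyN; apply/andP; split;
  by apply: leq_trans (size_scale_leq _ _) _; exact: size_poly_E.
Qed.

(** Up to a common factor this is the coefficient of degree [depth b m] in [num_poly]; its vanishing
    puts the degree of the numerator below the number of zeros. *)
Lemma rot_parity m :
  rot R b * 'i%C ^+ depth b m + (rot R b)^-1 * (- 'i%C) ^+ depth b m = 0.
Proof.
rewrite [(- 'i%C) ^+ _]exprNn /depth /rot -signr_odd oddD odd_double/=; case: b => /=.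
  by rewrite invr1 expr1 !mul1r mulN1r subrr.
by rewrite invi expr0 mul1r mulNr subrr.
Qed.

Lemma size_num_poly m : (size (num_poly (depth b m)) <= depth b m)%N.
Proof.
apply/leq_sizeP => j; rewrite leq_eqVlt => /predU1P[<-|jm].
  rewrite /num_poly !(coefZ, coefD, coef_poly_E) !mulrA -mulrDl rot_parity.
  by rewrite mul0r mulr0.
apply: nth_default; apply: leq_trans jm.
apply: leq_trans (size_scale_leq _ _) _; apply: leq_trans (size_polyD _ _) _.
rewrite geq_max; apply/andP; split;
  by apply: leq_trans (size_scale_leq _ _) _; exact: size_poly_E.
Qed.

Lemma deriv_den_poly N x : den N x%:C = 0 ->
  ((den_poly N)^`()).[x%:C] = (slope q N x)%:C * num N x%:C.
Proof.
move=> D0.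
have dE : ((poly_E 'i%C N)^`()).[x%:C] = trunc_E q N x%:C * logder q N x.
  rewrite /poly_E (deriv_prod_linear (c := iweight q))//.
  by move=> j; exact: iweight_real_neq0.
have dEN : ((poly_E (- 'i%C) N)^`()).[x%:C] = - (trunc_E q N (- x%:C) * logder q N (- x)).
  rewrite /poly_E (deriv_prod_linear (c := fun j => - 'i%C * (weight q j)%:C)); last first.
    move=> j; have := iweight_real_neq0 q j (- x).
    by rewrite /iweight rmorphN/= mulrN !mulNr.
  rewrite -mulrN; congr (_ * _).
    by apply: eq_bigr => j _; rewrite /iweight mulrN !mulNr.
  rewrite /logder -sumrN; apply: eq_bigr => j _.
  by rewrite /iweight rmorphN/= mulrN !mulNr.
(* The added zero multiple of [den] supplies the real part of the logarithmic derivative; the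
   identity is then formal. *)
have -> : (slope q N x)%:C * num N x%:C =
    (slope q N x)%:C * num N x%:C + (slope_re q N x)%:C * den N x%:C.
  by rewrite D0 mulr0 addr0.
rewrite /den_poly derivZ derivB !derivZ hornerZ hornerD hornerN !hornerZ dE dEN.
rewrite !logderE slope_reN slopeN rmorphN/= /num_of /den_of.
by field; rewrite rot_neq0 i_neq0.
Qed.

Lemma num_neq0 N x : den N x%:C = 0 -> num N x%:C != 0.
Proof.
rewrite den_real num_real => -[/eqP]; rewrite oppr_eq0 mulf_eq0.
have m0 : modulus q N x != 0 by rewrite gt_eqF// (lt_le_trans _ (modulus_ge1 q N x)).
rewrite (negbTE m0)/= => /eqP s0.
rewrite -(rmorph0 (real_complex R)) (inj_eq (@complexI R)) oppr_eq0 mulf_neq0//.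
apply/eqP => c0; have := cos2Dsin2 (phase q N x - alpha R b).
by rewrite s0 c0 expr0n/= addr0 => /eqP; rewrite eq_sym oner_eq0.
Qed.

(** The origin is a zero in the sine case only, hence [b] copies of 0. In total there are 2m + b
    entries, the degree bound of the denominator. *)
Definition real_zeros (m : nat) : seq R :=
  nseq b 0 ++ [seq finite_zero q b m k | k <- iota 0 m]
           ++ [seq - finite_zero q b m k | k <- iota 0 m].

Lemma size_real_zeros m : size (real_zeros m) = depth b m.
Proof.
by rewrite /real_zeros !size_cat size_nseq !size_map size_iota /depth -addnn addnC.
Qed.

Lemma den_real_zeros m x : x \in real_zeros m -> den (depth b m) x%:C = 0.
Proof.
move=> xm; rewrite den_real; suff -> : sin (phase q (depth b m) x - alpha R b) = 0.
  by rewrite mulr0 oppr0.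
move: xm; rewrite !mem_cat => /or3P[|/mapP[k]|/mapP[k]].
- case: b => //; rewrite mem_nseq/= => /eqP ->.
  by rewrite phase0 sub0r sinN sinpi oppr0.
- rewrite mem_iota/= add0n => km ->; have [_ ->] := finite_zeroP b q01 km.
  by rewrite /angle addrK sin_natpi.
(* At a negative zero the sine is taken at - (k pi + 2 alpha), and 2 alpha is 2 pi or pi. *)
rewrite mem_iota/= add0n => km ->; rewrite phaseN; have [_ ->] := finite_zeroP b q01 km.
rewrite -opprD sinN /angle /alpha; case: b.
  have -> : k%:R * pi + pi + pi = k.+2%:R * pi :> R by rewrite -addn2 natrD; ring.
  by rewrite sin_natpi oppr0.
have -> : k%:R * pi + pi / 2 + pi / 2 = k.+1%:R * pi :> R by rewrite -addn1 natrD; field.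
by rewrite sin_natpi oppr0.
Qed.

Lemma uniq_real_zeros m : uniq (real_zeros m).
Proof.
have fz k : (k \in iota 0 m) -> 0 < finite_zero q b m k.
  rewrite mem_iota/= add0n => km.
  exact: lt_le_trans (finite_zero_ge1 b q01 km).
have inj : {in iota 0 m &, injective (finite_zero q b m)}.
  move=> k l; rewrite !mem_iota/= !add0n => km lm kl.
  have [_ pk] := finite_zeroP b q01 km; have [_ pl] := finite_zeroP b q01 lm.
  have : angle R b k = angle R b l by rewrite -pk -pl kl.
  move/addIr/mulIf; rewrite gt_eqF ?pi_gt0// => /(_ isT)/eqP.
  by rewrite eqr_nat => /eqP.
rewrite /real_zeros !cat_uniq; apply/and5P; split.
- by case: b.
- rewrite -all_predC; apply/allP => x; rewrite mem_cat => xin /=.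
  rewrite mem_nseq negb_and; apply/orP; right.
  by case/orP : xin => /mapP[k /fz fk ->]; rewrite ?oppr_eq0 gt_eqF.
- by rewrite map_inj_in_uniq ?iota_uniq.
- rewrite -all_predC; apply/allP => _ /mapP[k /fz fk ->] /=.
  apply/mapP => -[l /fz fl] kl; move: fl; rewrite -kl oppr_gt0.
  by move/(lt_trans fk); rewrite ltxx.
- rewrite map_inj_in_uniq ?iota_uniq// => k l kin lin /oppr_inj.
  exact: inj.
Qed.

(** Every residue is 1 / slope and the slope is even, so opposite zeros combine by 1/(z - y) + 1/(z
    + y) = 2z/(z^2 - y^2). The unit disc contains no zero but the origin. *)
Lemma num_den_partial_fractions m z :
    z != 0 -> normc z < 1 -> (0 < m)%N ->
  z * num (depth b m) z = den (depth b m) z *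
   (b%:R * ((slope q (depth b m) 0)^-1)%:C +
    \sum_(k < m) 2 * ((slope q (depth b m) (finite_zero q b m k))^-1)%:C *
      z ^+ 2 / (z ^+ 2 - (finite_zero q b m k)%:C ^+ 2)).
Proof.
move=> z0 z1 m0; set N := depth b m.
pose rs := map (real_complex R) (real_zeros m).
have zr x : x \in real_zeros m -> z != x%:C.
  rewrite /real_zeros !mem_cat => xin; apply: contraTneq z1 => zx.
  have {}xin : (x == 0) || (1 <= `|x|).
    case/or3P : xin => [|/mapP[k]|/mapP[k]].
    - by rewrite mem_nseq => /andP[_ ->].
    - rewrite mem_iota/= add0n => km ->; apply/orP; right.
      exact: le_trans (finite_zero_ge1 b q01 km) (ler_norm _).
    - rewrite mem_iota/= add0n => km ->; apply/orP; right; rewrite normrN.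
      exact: le_trans (finite_zero_ge1 b q01 km) (ler_norm _).
  rewrite -leNgt zx normc_real; case/orP : xin => // /eqP x0.
  by move: z0; rewrite zx x0 eqxx.
have N0 : (0 < N)%N by exact: depth_gt0.
have sl0 x : slope q N x != 0 by rewrite gt_eqF// slope_gt0.
have slC0 x : (slope q N x)%:C != 0.
  by rewrite -(rmorph0 (real_complex R)) (inj_eq (@complexI R)).
have rsP r : r \in rs -> exists2 x, x \in real_zeros m & r = x%:C.
  by move=> /mapP[x xin ->]; exists x.
rewrite -horner_num_poly -horner_den_poly.
rewrite (@partial_fractions _ (den_poly N) (num_poly N) rs z); first last.
- by apply/negP => /rsP[x xin zx]; move: (zr _ xin); rewrite zx eqxx.
- by rewrite size_map size_real_zeros size_num_poly.
- by rewrite size_map size_real_zeros size_den_poly.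
- move=> _ /rsP[x xin ->]; have D0 := den_real_zeros xin.
  by rewrite deriv_den_poly// mulf_neq0// num_neq0.
- by move=> _ /rsP[x xin ->]; rewrite /root horner_den_poly den_real_zeros.
- by rewrite map_inj_uniq ?uniq_real_zeros//; exact: complexI.
rewrite mulrCA; congr (_ * _).
rewrite /rs big_map.
have -> : \sum_(x <- real_zeros m) (num_poly N).[x%:C] / (den_poly N)^`().[x%:C] / (z - x%:C) =
   \sum_(x <- real_zeros m) ((slope q N x)^-1)%:C / (z - x%:C).
  rewrite big_seq [RHS]big_seq; apply: eq_bigr => x xin.
  have D0 := den_real_zeros xin.
  rewrite deriv_den_poly// horner_num_poly invfM mulrCA mulfV ?mulr1 ?num_neq0//.
  by rewrite fmorphV.
rewrite /real_zeros !big_cat/= !big_map mulrDr; congr (_ + _).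
  case: b; rewrite /= ?big_seq1 ?big_nil ?mulr0 ?mul0r//.
  by rewrite subr0 mul1r mulrCA mulfV// mulr1.
have -> : iota 0 m = index_iota 0 m by rewrite /index_iota subn0.
rewrite !big_mkord -big_split/= mulr_sumr.
apply: eq_bigr => k _; rewrite slopeN rmorphN/= opprK.
set y := finite_zero q b m k.
have yin : y \in real_zeros m.
  by rewrite /real_zeros !mem_cat map_f ?orbT// mem_iota/= add0n ltn_ord.
have yNin : - y \in real_zeros m.
  rewrite /real_zeros !mem_cat (map_f (fun k => - finite_zero q b m k)) ?orbT//.
  by rewrite mem_iota/= add0n ltn_ord.
have e1 : z - y%:C != 0 by rewrite subr_eq0 zr.
have e2 : z + y%:C != 0 by have := zr _ yNin; rewrite rmorphN/= -addr_eq0.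
have e3 : z ^+ 2 - y%:C ^+ 2 != 0 by rewrite subr_sqr mulf_neq0.
by field; apply/and4P; split; rewrite ?slC0.
Qed.

End FiniteExpansion.

(** * Power series of the quotient at the origin *)

Section Expansion.
Variables (R : realType) (q : R) (b : bool).
Hypothesis q01 : 0 < q < 1.
Implicit Types (z : R[i]).

Local Notation num N := (num_of b (trunc_E q N)).
Local Notation den N := (den_of b (trunc_E q N)).
Local Notation Num := (num_of b (lim_E q)).
Local Notation Den := (den_of b (lim_E q)).

Definition zeta_value (n : nat) : R := limn (series (zeta_term q b n)).

Definition finite_coef (m n : nat) : R :=
  if n is 0 then b%:R * (slope q (depth b m) 0)^-1 else - 2 * finite_zeta q b m n.

Definition coef (n : nat) : R :=
  if n is 0 then b%:R * (Slope q 0)^-1 else - 2 * zeta_value n.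

Lemma finite_coef_cvg n : finite_coef ^~ n @ \oo --> coef n.
Proof.
case: n => [|n] /=.
  have sl : (fun m => slope q (depth b m) 0) @ \oo --> Slope q 0.
    exact: (cvg_comp _ _ (@depth_cvg b) (@slope_cvg _ _ q01 0)).
  have S0 : Slope q 0 != 0 by rewrite gt_eqF// Slope_gt0.
  exact: (cvgM (cvg_cst _) (cvgV S0 sl)).
have [_ zc] := zeta_cvg b q01 (ltn0Sn n).
exact: (cvgM (cvg_cst _) zc).
Qed.

Lemma geometric_remainder (F : fieldType) (s t : F) M : t != 0 -> s - t != 0 ->
  s / (s - t) = - (\sum_(n < M) (s / t) ^+ n.+1) + (s / t) ^+ M * (s / (s - t)).
Proof.
move=> t0 st; elim: M => [|M IH].
  by rewrite big_ord0 oppr0 add0r expr0 mul1r.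
rewrite big_ord_recr/= {1}IH opprD -addrA; congr (_ + _).
by rewrite !exprS; field; rewrite t0 st.
Qed.

(** Since |z^2| <= 1/4 and y >= 1, the distance from z^2 to y^2 is at least 3/4 of y^2. The factor
    y^(-2) is retained so that the sum over the zeros stays below the dominating series. *)
Lemma remainder_le z (y : R) M : 1 <= y -> normc z <= 1 / 2 ->
  normc ((z ^+ 2 / y%:C ^+ 2) ^+ M * (z ^+ 2 / (z ^+ 2 - y%:C ^+ 2))) <=
    normc z ^+ M.*2 * (y ^+ 2)^-1.
Proof.
move=> y1 z2; have y0 : 0 < y by apply: lt_le_trans y1.
have z0 := normc_ge0 z.
have Y1 : 1 <= y ^+ 2 by rewrite exprn_ege1.
have Y0 : 0 < y ^+ 2 by apply: lt_le_trans Y1.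
have Z4 : normc (z ^+ 2) <= 1 / 4 by rewrite normcX; nra.
have Z0 := normc_ge0 (z ^+ 2).
have nY : normc (y%:C ^+ 2) = y ^+ 2 by rewrite normcX normc_real ger0_norm ?ltW.
have -> : normc z ^+ M.*2 = normc (z ^+ 2) ^+ M by rewrite normcX -exprM mul2n.
move: Z4 Z0 nY; set s := z ^+ 2; set t := y%:C ^+ 2 => Z4 Z0 nY.
have st : normc (s / t) <= normc s.
  rewrite ComplexField.Normc.normcM ComplexField.Normc.normcV nY.
  by rewrite ler_piMr// invf_le1.
have dst : y ^+ 2 - normc s <= normc (s - t).
  by rewrite -nY normcB; exact: ger0_normc_sub.
have d0 : 0 < normc (s - t) by lra.
rewrite ComplexField.Normc.normcM normcX; apply: ler_pM.
- by rewrite exprn_ge0 ?normc_ge0.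
- exact: normc_ge0.
- by apply: lerXn2r; rewrite ?nnegrE ?normc_ge0.
rewrite ComplexField.Normc.normcM ComplexField.Normc.normcV.
rewrite ler_pdivrMr// mulrC ler_pdivlMr//; nra.
Qed.

Lemma sum_dominated m :
  \sum_(k < m) (finite_zero q b m k ^+ 2 *
    slope q (depth b m) (finite_zero q b m k))^-1 <=
  limn (series (fun k => dominant q b * (q ^+ 2) ^+ k)).
Proof.
set D := fun k => dominant q b * (q ^+ 2) ^+ k.
have D0 k : 0 <= D k.
  by rewrite mulr_ge0 ?(dominant_ge0 b q01)//; apply: exprn_ge0; exact: sqr_ge0.
apply: (@le_trans _ _ (series D m)).
  by rewrite /series/= big_mkord; apply: ler_sum => k _; exact: slope_dominated.
apply: (nondecreasing_cvgn_le (u_ := series D)); last exact: dominant_cvg.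
by apply/nondecreasing_seqP => j; rewrite seriesSr lerDl.
Qed.

Definition remainder_bound : R :=
  2 * limn (series (fun k => dominant q b * (q ^+ 2) ^+ k)).

(** Expanding each pole term geometrically turns the power sums over the zeros into [finite_coef],
    and only the remainders are estimated. The constant is uniform in [m], and the product form
    passes to the limit while [Den z] could still vanish. *)
Lemma finite_expansion_le m M z : (0 < m)%N -> z != 0 -> normc z <= 1 / 2 ->
  normc (z * num (depth b m) z -
      den (depth b m) z * \sum_(n < M.+1) (finite_coef m n)%:C * z ^+ n.*2) <=
    normc (den (depth b m) z) * (remainder_bound * normc z ^+ M.*2).
Proof.
move=> m0 z0 z2; rewrite num_den_partial_fractions//; last by lra.
rewrite -mulrBr ComplexField.Normc.normcM ler_wpM2l ?normc_ge0//.
rewrite big_ord_recl/= expr0 mulr1 rmorphM/= rmorph_nat opprD addrACA subrr add0r.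
pose y k := finite_zero q b m k; pose rho k := (slope q (depth b m) (y k))^-1.
have -> : \sum_(i < M) (finite_coef m (bump 0 i))%:C * z ^+ (bump 0 i).*2 =
   \sum_(k < m) - (2 * (rho k)%:C) * \sum_(i < M) (z ^+ 2 / (y k)%:C ^+ 2) ^+ i.+1.
  under [RHS]eq_bigr do rewrite mulr_sumr.
  rewrite exchange_big/=; apply: eq_bigr => i _.
  rewrite /bump/= add1n /finite_coef /finite_zeta mulr_sumr rmorph_sum/= mulr_suml.
  apply: eq_bigr => k _; rewrite -/(y k) invfM -/(rho k) rmorphM/= rmorphM/= rmorphN/=.
  rewrite rmorph_nat fmorphV/= rmorphXn/= -mul2n !exprM expr_div_n.
  by rewrite !mulNr; congr (- _); ring.
rewrite -sumrB.
have -> : \sum_(k < m) (2 * (rho k)%:C * z ^+ 2 / (z ^+ 2 - (y k)%:C ^+ 2) -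
    - (2 * (rho k)%:C) * \sum_(i < M) (z ^+ 2 / (y k)%:C ^+ 2) ^+ i.+1) =
  \sum_(k < m) (2 * (rho k)%:C) *
    ((z ^+ 2 / (y k)%:C ^+ 2) ^+ M * (z ^+ 2 / (z ^+ 2 - (y k)%:C ^+ 2))).
  apply: eq_bigr => k _.
  have y1 : 1 <= y k := finite_zero_ge1 b q01 (ltn_ord k).
  have yC0 : (y k)%:C ^+ 2 != 0.
    rewrite expf_eq0/= -(rmorph0 (real_complex R)) (inj_eq (@complexI R)).
    by rewrite gt_eqF// (lt_le_trans _ y1).
  have zy0 : z ^+ 2 - (y k)%:C ^+ 2 != 0.
    rewrite subr_eq0; apply/eqP => /(congr1 (@ComplexField.Normc.normc R)).
    rewrite !normcX normc_real ger0_norm ?(le_trans _ y1)//.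
    by have := normc_ge0 z; nra.
  rewrite -mulrA {1}(geometric_remainder M yC0 zy0) mulrDr mulNr opprK mulrN.
  by rewrite addrAC addNr add0r.
apply: le_trans (normc_sum _ _ _) _.
apply: (@le_trans _ _ (\sum_(k < m) 2 * ((y k ^+ 2 *
    slope q (depth b m) (y k))^-1 * normc z ^+ M.*2))).
  apply: ler_sum => k _; have y1 : 1 <= y k := finite_zero_ge1 b q01 (ltn_ord k).
  have r0 : 0 <= rho k by rewrite invr_ge0 ltW// slope_gt0// depth_gt0.
  rewrite ComplexField.Normc.normcM ComplexField.Normc.normcM normc_real (ger0_norm r0).
  rewrite normc_nat.
  rewrite -mulrA ler_pM2l// [(_ * slope _ _ _)^-1]invfM -/(rho k).
  have := ler_wpM2l r0 (remainder_le M y1 z2).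
  by congr (_ <= _); ring.
rewrite -mulr_sumr -mulr_suml /remainder_bound -mulrA ler_pM2l//.
by rewrite ler_wpM2r ?exprn_ge0 ?normc_ge0// sum_dominated.
Qed.

Lemma expansion_le M z : z != 0 -> normc z <= 1 / 2 ->
  normc (z * Num z - Den z * \sum_(n < M.+1) (coef n)%:C * z ^+ n.*2) <=
    normc (Den z) * (remainder_bound * normc z ^+ M.*2).
Proof.
move=> z0 z2.
have numc : (fun m => num (depth b m) z) @ \oo --> Num z.
  exact: (cvg_comp _ _ (@depth_cvg b) (@num_cvg _ _ b q01 z)).
have denc : (fun m => den (depth b m) z) @ \oo --> Den z.
  exact: (cvg_comp _ _ (@depth_cvg b) (@den_cvg _ _ b q01 z)).
have sumc : (fun m => \sum_(n < M.+1) (finite_coef m n)%:C * z ^+ n.*2) @ \oo -->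
    \sum_(n < M.+1) (coef n)%:C * z ^+ n.*2.
  elim: M.+1 => [|k IH].
    under eq_fun do rewrite big_ord0; rewrite big_ord0; exact: cvg_complex_cst.
  under eq_fun do rewrite big_ord_recr/=; rewrite big_ord_recr/=.
  apply: (cvg_complexD IH); apply: cvg_complexM (cvg_complex_cst _).
  by apply: cvg_real_complex; exact: finite_coef_cvg.
have c1 := cvg_normc (cvg_complexB (cvg_complexMl (b := z) numc) (cvg_complexM denc sumc)).
set K := remainder_bound * normc z ^+ M.*2.
have c2 : (fun m => normc (den (depth b m) z) * K) @ \oo --> normc (Den z) * K.
  exact: (cvgM (cvg_normc denc) (cvg_cst K)).
apply: (ler_cvg_to c1 c2); exists 1%N => // m /= m0.
exact: finite_expansion_le.
Qed.

(** If [Den z = 0], the case [M = 0] of the expansion forces [Num z = 0]; but Num z + i Den z is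
    [rot] times E z, which is nonzero near the origin. *)
Lemma Den_neq0 z : z != 0 -> normc z <= 1 / 4 -> Den z != 0.
Proof.
move=> z0 z4; apply/negP => /eqP D0.
have z2 : normc z <= 1 / 2 by lra.
have := @expansion_le 0 z z0 z2.
rewrite D0 mul0r subr0 ComplexField.Normc.normc0 mul0r => h.
have : normc (z * Num z) == 0 by rewrite eq_le h normc_ge0.
rewrite normc_eq0 mulf_eq0 (negbTE z0)/= => /eqP N0.
have E0 : lim_E q z != 0 by apply: lim_E_neq0.
have : rot R b * lim_E q z = Num z + 'i%C * Den z.
  by rewrite /num_of /den_of; field; rewrite rot_neq0 i_neq0.
rewrite N0 D0 mulr0 addr0 => /eqP.
by rewrite mulf_eq0 (negbTE E0) orbF (negbTE (rot_neq0 R b)).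
Qed.

Lemma quotient_expansion z : z != 0 -> normc z <= 1 / 4 ->
  (fun M => \sum_(n < M) (coef n)%:C * z ^+ n.*2) @ \oo --> z * Num z / Den z.
Proof.
move=> z0 z4; have D0 := Den_neq0 z0 z4.
have z2 : normc z <= 1 / 2 by lra.
rewrite -cvg_shiftS.
have g : (fun M => remainder_bound * (normc z ^+ 2) ^+ M) @ \oo --> 0.
  rewrite -[X in _ --> X](mulr0 remainder_bound); apply: cvgM; first exact: cvg_cst.
  apply: cvg_expr; rewrite ger0_norm ?sqr_ge0// expr_lt1 ?normc_ge0//; lra.
apply: (cvg_complex_squeeze _ g); near=> M.
rewrite normcB -exprM mul2n -(ler_pM2l (_ : 0 < normc (Den z))) ?normc_gt0//.
apply: le_trans (expansion_le M z0 z2).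
rewrite -ComplexField.Normc.normcM mulrBr mulrCA mulfV// mulr1.
by [].
Unshelve. all: by end_near. Qed.

End Expansion.

(** * Uniqueness of increasing enumerations and of power series coefficients *)

Section Uniqueness.
Variable R : realType.

(** If two enumerations agree below [n], the value [g n] occurs in [f] at an index not below [n], so
    [f n <= g n]; the roles are symmetric. *)
Lemma increasing_enumeration_unique (u v : R^nat) :
  increasing_seq u -> increasing_seq v -> range u = range v -> u = v.
Proof.
move=> iu iv uv; apply/funext => n; elim/ltn_ind: n => n IH.
have le_enum (f g : R^nat) : increasing_seq f -> increasing_seq g ->
    range f = range g -> (forall m, (m < n)%N -> f m = g m) -> f n <= g n.
  move=> fi gi fg fgn; have [m _ fm] : range f (g n) by rewrite fg; exists n.
  rewrite -fm fi leqNgt; apply/negP => mn; move: (fm); rewrite fgn// => gmn.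
  by have := gi n m; rewrite gmn lexx leqNgt mn.
apply/eqP; rewrite eq_le !le_enum//.
by move=> m mn; rewrite IH.
Qed.

Lemma positive_zerosE (f : R[i] -> R[i]) (u : R^nat) :
  enumerates_positive_zeros f u -> positive_zeros f = u.
Proof.
move=> fu; have [iu ru] := fu.
have [iv rv] : enumerates_positive_zeros f (positive_zeros f) by apply: getPex; exists u.
by apply: increasing_enumeration_unique => //; rewrite rv ru.
Qed.

(* Dividing by [x ^ m] leaves [d m] plus a tail of order [x]. *)
Lemma power_series0 (d : (R[i])^nat) (r : R) : 0 < r ->
    (forall x : R, 0 < x <= r -> series (fun n => d n * x%:C ^+ n) @ \oo --> (0 : R[i])) ->
  forall n, d n = 0.
Proof.
move=> r0 dcvg; elim/ltn_ind => m IH.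
(* A term at [x = r] is the difference of two partial sums, and convergent partial sums are
   bounded. *)
have [B [B0 dB]] : exists B, 0 <= B /\ forall n, normc (d n) * r ^+ n <= B.
  have cr : series (fun n => d n * r%:C ^+ n) @ \oo --> (0 : R[i]).
    by apply: dcvg; rewrite r0 lexx.
  have /cvg_normc := cr; rewrite ComplexField.Normc.normc0 => /cvgP /cvg_seq_bounded.
  case=> B [_ /(_ (B + 1))]; rewrite ltrDl ltr01 => /(_ isT) bnd.
  have B1 k : normc (series (fun n => d n * r%:C ^+ n) k) <= B + 1.
    by have h := bnd k I; rewrite /= ger0_norm ?normc_ge0 in h.
  exists (2 * (B + 1)); split.
    by have := B1 0%N; have := normc_ge0 (series (fun n => d n * r%:C ^+ n) 0%N); lra.
  move=> n; have -> : normc (d n) * r ^+ n = normc (d n * r%:C ^+ n).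
    by rewrite ComplexField.Normc.normcM normcX normc_real gtr0_norm.
  rewrite -(seriesSB (fun n => d n * r%:C ^+ n) n).
  apply: le_trans (le_normcD _ _) _; rewrite normcN.
  by have := B1 n; have := B1 n.+1; lra.
(* For [x <= r / 2] the tail is dominated by a geometric series of ratio at most 1/2, whence the
   factor 2. *)
have key x : 0 < x <= r / 2 -> normc (d m) <= 2 * B * x / r ^+ m.+1.
  move=> /andP[x0 xr]; pose p := x / r.
  have p0 : 0 <= p by rewrite divr_ge0// ltW.
  have p2 : p <= 1 / 2 by rewrite ler_pdivrMr//; lra.
  have xp j : x ^+ j = p ^+ j * r ^+ j by rewrite -exprMn divfK// gt_eqF.
  have geo k : \sum_(i < k) p ^+ i <= 2.
    have := subrX1 p k; have := exprn_ge0 k p0.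
    set S := \sum_(_ < _) _; have S0 : 0 <= S by apply: sumr_ge0 => i _; exact: exprn_ge0.
    by nra.
  have tail k : normc (\sum_(m.+1 <= j < m.+1 + k) d j * x%:C ^+ j) <= 2 * B * p ^+ m.+1.
    apply: le_trans (normc_sum _ _ _) _.
    apply: (@le_trans _ _ (\sum_(m.+1 <= j < m.+1 + k) B * p ^+ j)).
      apply: ler_sum => j _; rewrite ComplexField.Normc.normcM normcX normc_real.
      rewrite (gtr0_norm x0) xp mulrCA mulrC ler_wpM2r ?exprn_ge0//.
    have -> : \sum_(m.+1 <= j < m.+1 + k) B * p ^+ j =
        B * p ^+ m.+1 * \sum_(i < k) p ^+ i.
      elim: k => [|k IHk]; first by rewrite addn0 big_geq// big_ord0 mulr0.
      by rewrite addnS big_nat_recr ?leq_addr//= IHk big_ord_recr/= exprD; ring.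
    rewrite [X in _ <= X * _]mulrC -mulrA -[leRHS]mulrA ler_wpM2l// mulrC.
    by rewrite ler_wpM2r ?exprn_ge0.
  have lim0 : (fun n => normc (series (fun n => d n * x%:C ^+ n) n)) @ \oo --> 0.
    rewrite -(ComplexField.Normc.normc0 R); apply: cvg_normc; apply: dcvg.
    by rewrite x0 /=; lra.
  have : normc (d m) * x ^+ m - 2 * B * p ^+ m.+1 <= 0.
    apply: (cvgr_to_ge lim0); exists m.+1 => // n /= mn.
    rewrite -(subnKC mn) /series/= (big_cat_nat (n := m.+1)) ?leq_addr//=.
    rewrite big_nat_recr//= big_nat big1 ?add0r; last first.
      by move=> j /andP[_ jm]; rewrite IH// mul0r.
    have -> : normc (d m) * x ^+ m = normc (d m * x%:C ^+ m).
      by rewrite ComplexField.Normc.normcM normcX normc_real gtr0_norm.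
    have := tail (n - m.+1)%N; set T := \sum_(_ <= _ < _) _ => hT.
    have := ger0_normc_sub (d m * x%:C ^+ m) (- T); rewrite opprK normcN.
    by lra.
  rewrite subr_le0 /p expr_div_n exprS mulrA mulrA -[leRHS]mulrAC => h.
  rewrite -(ler_pM2r (exprn_gt0 m x0)); apply: le_trans h _.
  by rewrite le_eqVlt; apply/orP; left; apply/eqP; ring.
apply/eqP; rewrite -normc_eq0 eq_le normc_ge0 andbT.
have rm0 : 0 < r ^+ m.+1 by rewrite exprn_gt0.
pose K := 2 * B * (r / 2) / r ^+ m.+1.
have c : (fun k : nat => K * k.+1%:R^-1) @ \oo --> K * 0.
  exact: (cvgM (cvg_cst K) cvg_harmonic).
rewrite mulr0 in c.
apply: (cvgr_to_ge c); exists 0%N => // k _.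
have -> : K * k.+1%:R^-1 = 2 * B * (r / 2 * k.+1%:R^-1) / r ^+ m.+1.
  by rewrite /K; ring.
apply: key.
have k0 : 0 < k.+1%:R^-1 :> R by rewrite invr_gt0.
have k1 : k.+1%:R^-1 <= 1 :> R by rewrite invf_le1// ler1n.
by rewrite mulr_gt0 ?divr_gt0//= ler_piMr// divr_ge0// ltW.
Qed.

End Uniqueness.

(** * Coefficients of the two generating functions *)

Section Coefficients.
Variables (R : realType) (q : R).
Hypothesis q01 : 0 < q < 1.

Lemma qfactorial_neq0 n : (qfactorial q n)%:C != 0.
Proof.
rewrite -(rmorph0 (real_complex R)) (inj_eq (@complexI R)) gt_eqF//.
case/andP: q01 => q0 q1; rewrite /qfactorial big_nat; apply: prodr_gt0 => k /andP[k0 _].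
by rewrite divr_gt0 ?subr_gt0// exprn_ilt1 ?ltW// -lt0n.
Qed.

(** Two expansions are both valid on some punctured disc; its positive reals suffice for
    [power_series0]. *)
Lemma expansion_coefficientsE (f : R[i] -> R[i]) (a : (R[i])^nat) :
  expands_near0 q f a -> expansion_coefficients q f = a.
Proof.
move=> fa; set a' := expansion_coefficients q f.
have fa' : expands_near0 q f a' by apply: getPex; exists a.
have [e e0 ball_e] := filterI fa fa'.
have ereal : complex.Im e = 0 by have : 0 < e := e0; rewrite ltcE => /andP[/eqP].
have e0' : 0 < complex.Re e by have : 0 < e := e0; rewrite ltcE => /andP[].
pose d n := (a' n - a n) / (qfactorial q n)%:C.
have d0 : forall n, d n = 0.
  apply: (@power_series0 _ _ (complex.Re e / 2)); first by rewrite divr_gt0.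
  move=> x /andP[x0 xe].
  have [||c c'] := ball_e x%:C.
  - rewrite /ball_/= sub0r normrN ltcE /= ereal eqxx /=.
    rewrite -[X in X < _]/(normc x%:C) normc_real gtr0_norm//; lra.
  - by rewrite -(rmorph0 (real_complex R)) (inj_eq (@complexI R)) gt_eqF.
  rewrite -(subrr (f x%:C)).
  have -> : series (fun n => d n * x%:C ^+ n) = (fun n =>
      series (fun n => a' n * (x%:C ^+ n / (qfactorial q n)%:C)) n -
      series (fun n => a n * (x%:C ^+ n / (qfactorial q n)%:C)) n).
    apply/funext => n; rewrite /series/= -sumrB; apply: eq_bigr => k _.
    by rewrite /d; ring.
  exact: (cvg_complexB c' c).
apply/funext => n; have := d0 n; rewrite /d => /eqP.
by rewrite mulf_eq0 invr_eq0 (negbTE (qfactorial_neq0 n)) orbF subr_eq0 => /eqP.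
Qed.

(** [uphalf N] counts the even indices below [N]. *)
Lemma series_even_terms (g : (R[i])^nat) (z : R[i]) N :
  \sum_(n < N) (if odd n then 0 else g n./2) * z ^+ n =
  \sum_(n < uphalf N) g n * z ^+ n.*2.
Proof.
elim: N => [|N IH]; first by rewrite !big_ord0.
rewrite big_ord_recr/= IH uphalf_half; case: ifP => oN /=.
  by rewrite mul0r addr0.
by rewrite add0n big_ord_recr/= even_halfK// oN.
Qed.

Lemma uphalf_cvg : uphalf @ \oo --> \oo.
Proof.
by apply/cvgnyPge => A; exists A.*2 => // N /=; rewrite uphalf_half; lia.
Qed.

Lemma cvg_even_terms (g : (R[i])^nat) (z l : R[i]) :
    (fun M => \sum_(n < M) g n * z ^+ n.*2) @ \oo --> l ->
  series (fun n => (if odd n then 0 else g n./2) * z ^+ n) @ \oo --> l.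
Proof.
move=> gl; have -> : series (fun n => (if odd n then 0 else g n./2) * z ^+ n) =
    (fun N => \sum_(n < uphalf N) g n * z ^+ n.*2).
  by apply/funext => N; rewrite /series/= big_mkord series_even_terms.
exact: (cvg_comp _ _ uphalf_cvg gl).
Qed.

Lemma cvg_single_term (k : nat) (c z : R[i]) :
  series (fun n => ((n == k)%:R * c) * z ^+ n) @ \oo --> c * z ^+ k.
Proof.
apply: cvg_near_cst; exists k.+1 => // N /= kN; rewrite /series/=.
rewrite (big_cat_nat (n := k.+1))//= big_nat_recr//= eqxx mul1r.
rewrite big_nat big1 ?add0r; last by move=> i /andP[_ ik]; rewrite (ltn_eqF ik) !mul0r.
rewrite big_nat big1 ?addr0// => i /andP[ki _].
by rewrite (gtn_eqF ki) !mul0r.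
Qed.

(* The ratio [z / t] in the change of variables [t = 2 * 'i%C * z]. *)
Definition half_arg : R[i] := (2 * 'i%C)^-1.

Local Notation kappa := half_arg.

Lemma two_i_neq0 : 2 * 'i%C != 0 :> R[i].
Proof. by rewrite mulf_neq0 ?i_neq0// pnatr_eq0. Qed.

Lemma rescale_term (c z f : R[i]) k : f != 0 ->
  c * kappa ^+ k * f * ((z * (2 * 'i%C)) ^+ k / f) = c * z ^+ k.
Proof.
move=> f0; rewrite /half_arg exprMn exprVn.
have := expf_neq0 k two_i_neq0; set w := (2 * 'i%C) ^+ k => w0.
by field; rewrite f0 w0.
Qed.

Lemma near0_half_arg (P : R[i] -> Prop) :
    (forall z : R[i], z != 0 -> normc z <= 1 / 4 -> P (z * (2 * 'i%C))) ->
  \forall t \near 0^', P t.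
Proof.
(* The radius 1/4 in [z] multiplied by the modulus 2 of 2i. *)
move=> Pz; exists (1 / 2); first by rewrite /= divr_gt0.
move=> t /=; rewrite sub0r normrN => t2 t0.
have -> : t = (t * kappa) * (2 * 'i%C) by rewrite mulfVK ?two_i_neq0.
have n2 : normc (2 * 'i%C : R[i]) = 2.
  by rewrite ComplexField.Normc.normcM normc_i mulr1 normc_nat.
apply: Pz; first by rewrite mulf_neq0// invr_eq0 two_i_neq0.
rewrite ComplexField.Normc.normcM ComplexField.Normc.normcV n2 ler_pdivrMr//.
have h : normc t < 1 / 2.
  rewrite -ltcR; apply: lt_le_trans t2 _.
  by rewrite rmorphM/= fmorphV/= rmorph1 rmorph_nat.
lra.
Qed.

Local Notation E := (lim_E q).
Local Notation Num b := (num_of b (lim_E q)).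
Local Notation Den b := (den_of b (lim_E q)).

Lemma E_q_two_i (z : R[i]) : E_q q (z * (2 * 'i%C) / 2) = E z.
Proof. by rewrite /lim_E; congr (E_q q _); field. Qed.

(** [e_q u] is the reciprocal of [E_q (- u)], here at u = iz. *)
Lemma e_q_two_i (z : R[i]) : e_q q (z * (2 * 'i%C) / 2) = (E (- z))^-1.
Proof.
rewrite /e_q -qpochhammer_lim_E mul1r; congr (qpochhammer q _)^-1.
by field.
Qed.

(** Read off from t / (E(z)/E(-z) - 1) = z Cos_q z / Sin_q z - iz with t = 2iz. *)
Definition bernoulli_coef (n : nat) : R[i] :=
  (if odd n then 0 else (coef q true n./2)%:C) + (n == 1)%:R * - 'i%C.

(** Read off from 2 / (E(z)/E(-z) + 1) = 1 - i Sin_q z / Cos_q z. The known expansion is that of the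
    tangent times z, hence the index [n.+1]. *)
Definition euler_coef (n : nat) : R[i] :=
  (if odd n.+1 then 0 else (coef q false n.+1./2)%:C) * 'i%C + (n == 0)%:R * 1.

Lemma bernoulli_expansion (z : R[i]) : z != 0 -> normc z <= 1 / 4 ->
  series (fun n => bernoulli_coef n * z ^+ n) @ \oo -->
    (z * (2 * 'i%C)) / ((E (- z))^-1 * E z - 1).
Proof.
move=> z0 z4; have D0 := Den_neq0 true q01 z0 z4.
have E0 : E (- z) != 0 by apply: (lim_E_neq0 q01); rewrite normcN.
have -> : (z * (2 * 'i%C)) / ((E (- z))^-1 * E z - 1) =
    z * Num true z / Den true z + - 'i%C * z ^+ 1.
  move: D0; rewrite /num_of /den_of /rot invr1 !mul1r expr1.
  rewrite mulf_eq0 invr_eq0 (negbTE two_i_neq0) orbF => D0.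
  by field; rewrite E0 D0 i_neq0.
have -> : series (fun n => bernoulli_coef n * z ^+ n) = (fun N =>
    series (fun n => (if odd n then 0 else (coef q true n./2)%:C) * z ^+ n) N +
    series (fun n => ((n == 1%N)%:R * - 'i%C) * z ^+ n) N).
  apply/funext => N; rewrite /series/= -big_split/=; apply: eq_bigr => n _.
  by rewrite -mulrDl.
apply: cvg_complexD; last exact: cvg_single_term.
by apply: (cvg_even_terms (g := fun n => (coef q true n)%:C)); exact: quotient_expansion.
Qed.

Lemma euler_expansion (z : R[i]) : z != 0 -> normc z <= 1 / 4 ->
  series (fun n => euler_coef n * z ^+ n) @ \oo -->
    2 / ((E (- z))^-1 * E z + 1).
Proof.
move=> z0 z4; have D0 := Den_neq0 false q01 z0 z4.
have E0 : E (- z) != 0 by apply: (lim_E_neq0 q01); rewrite normcN.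
have -> : 2 / ((E (- z))^-1 * E z + 1) =
    'i%C / z * (z * Num false z / Den false z) + 1 * z ^+ 0.
  have D2 : E z + E (- z) != 0.
    apply: contra_neq D0 => D2; rewrite /den_of /rot invi mulNr opprK -mulrDr D2.
    by rewrite mulr0 mul0r.
  have Den2 : Den false z = (E z + E (- z)) / 2.
    rewrite /den_of /rot /= invi mulNr opprK -mulrDr. by field; rewrite i_neq0.
  have Num2 : Num false z = 'i%C * (E z - E (- z)) / 2.
    by rewrite /num_of /rot invi; field.
  have i2 : 'i%C * ('i%C * (E z - E (- z))) = - (E z - E (- z)).
    by rewrite mulrA -expr2 sqr_i mulN1r.
  rewrite Den2 Num2.
  have -> : 'i%C / z * (z * ('i%C * (E z - E (- z)) / 2) / ((E z + E (- z)) / 2)) =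
     'i%C * ('i%C * (E z - E (- z))) / (E z + E (- z)) by field; rewrite z0 D2.
  by rewrite i2; field; rewrite E0 D2.
have -> : series (fun n => euler_coef n * z ^+ n) = (fun N => 'i%C / z *
    series (fun n => (if odd n then 0 else (coef q false n./2)%:C) * z ^+ n) N.+1 +
    series (fun n => ((n == 0%N)%:R * 1) * z ^+ n) N).
  (* The term of index 0 vanishes because [coef q false 0] is 0, so division by [z] is a mere shift
     of the index. *)
  apply/funext => N; rewrite /series/= [X in 'i%C / z * X]big_nat_recl//=.
  rewrite mul0r rmorph0 mul0r add0r mulr_sumr -big_split/=; apply: eq_bigr => n _.
  rewrite /euler_coef mulrDl; congr (_ + _).
  by rewrite exprS/=; case: ifP => _; field.
apply: cvg_complexD; last exact: cvg_single_term.
apply: cvg_complexMl.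
have := cvg_even_terms (g := fun n => (coef q false n)%:C)
  (@quotient_expansion _ _ false q01 _ z0 z4).
by rewrite -cvg_shiftS.
Qed.

Lemma qBernoulliE n :
  qBernoulli q n / (qfactorial q n)%:C = bernoulli_coef n * kappa ^+ n.
Proof.
pose a k := bernoulli_coef k * kappa ^+ k * (qfactorial q k)%:C.
have -> : qBernoulli q = a.
  apply: expansion_coefficientsE; apply: near0_half_arg => z z0 z4.
  rewrite E_q_two_i e_q_two_i.
  have -> : (fun k => a k * ((z * (2 * 'i%C)) ^+ k / (qfactorial q k)%:C)) =
     (fun k => bernoulli_coef k * z ^+ k).
    by apply/funext => k; rewrite /a rescale_term// qfactorial_neq0.
  exact: bernoulli_expansion.
by rewrite /a mulfK ?qfactorial_neq0.
Qed.

Lemma qEulerE n :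
  qEuler q n / (qfactorial q n)%:C = euler_coef n * kappa ^+ n.
Proof.
pose a k := euler_coef k * kappa ^+ k * (qfactorial q k)%:C.
have -> : qEuler q = a.
  apply: expansion_coefficientsE; apply: near0_half_arg => z z0 z4.
  rewrite E_q_two_i e_q_two_i.
  have -> : (fun k => a k * ((z * (2 * 'i%C)) ^+ k / (qfactorial q k)%:C)) =
     (fun k => euler_coef k * z ^+ k).
    by apply/funext => k; rewrite /a rescale_term// qfactorial_neq0.
  exact: euler_expansion.
by rewrite /a mulfK ?qfactorial_neq0.
Qed.

End Coefficients.

(** * Zeta values *)

Section Conclusion.
Variables (R : realType) (q : R).
Hypothesis q01 : 0 < q < 1.

Lemma Sin_qE : Sin_q q = den_of true (lim_E q).
Proof.
by apply/funext => z; rewrite /Sin_q /den_of /lim_E /= invr1 !mul1r mulrN.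
Qed.

Lemma Cos_qE : Cos_q q = num_of true (lim_E q).
Proof.
by apply/funext => z; rewrite /Cos_q /num_of /lim_E /= invr1 !mul1r mulrN.
Qed.

Lemma Cos_qE' : Cos_q q = den_of false (lim_E q).
Proof.
apply/funext => z; rewrite /Cos_q /den_of /lim_E /= invi mulrN.
by field; rewrite i_neq0.
Qed.

Lemma Sin_qE' z : Sin_q q z = - num_of false (lim_E q) z.
Proof.
rewrite /Sin_q /num_of /lim_E /rot invi mulrN invfM invi.
by field.
Qed.

Lemma xiE : xi q = zero q true.
Proof. by rewrite /xi Sin_qE; apply: positive_zerosE; exact: zero_enumerates. Qed.

Lemma etaE : eta q = zero q false.
Proof. by rewrite /eta Cos_qE'; apply: positive_zerosE; exact: zero_enumerates. Qed.

Lemma cpow_nat (x : R) n : 0 <= x -> cpow x n%:R = (x ^+ n)%:C.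
Proof.
move=> x0; rewrite /cpow -(rmorph_nat (real_complex R)) /= powR_mulrn//.
by rewrite mul0r cos0 sin0 mulr1.
Qed.

Lemma mul_div_cancel (F : fieldType) (a s x : F) :
  a != 0 -> a / (s * a) * (1 / x) = (x * s)^-1.
Proof. by move=> a0; rewrite mul1r !invfM mulrCA mulfV// mulr1 mulrC. Qed.

(** The derivative of [Den] at a zero is [Slope] times [Num], so each coefficient of the series is 1
    / Slope. *)
Lemma zeta_seriesE n : zeta_series q (2 * n)%N%:R =
  (fun N => (series (zeta_term q true n) N)%:C).
Proof.
apply/funext => N; rewrite /zeta_series /series/= rmorph_sum/=; apply: eq_bigr => k _.
rewrite xiE Cos_qE Sin_qE derive1_Den// cpow_nat ?zero_ge0// mul2n.
have N0 := Num_zero_neq0 true q01 k.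
by rewrite mul_div_cancel// /zeta_term fmorphV rmorphM.
Qed.

Lemma zeta_star_seriesE n : zeta_star_series q (2 * n)%N%:R =
  (fun N => (- series (zeta_term q false n) N)%:C).
Proof.
apply/funext => N; rewrite /zeta_star_series /series/= rmorphN rmorph_sum/= -sumrN.
apply: eq_bigr => k _.
rewrite etaE Sin_qE' Cos_qE' derive1_Den// cpow_nat ?zero_ge0// mul2n.
have N0 := Num_zero_neq0 false q01 k.
by rewrite !mulNr mul_div_cancel// /zeta_term fmorphV rmorphM.
Qed.

Lemma half_arg_sqr n : (half_arg R) ^+ (2 * n) = ((-1) ^+ n * 4 ^- n).
Proof.
have -> : (half_arg R) ^+ (2 * n) = (half_arg R ^+ 2) ^+ n by rewrite exprM.
have -> : half_arg R ^+ 2 = - 1 / 4.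
  by rewrite /half_arg exprVn exprMn sqr_i; field.
by rewrite expr_div_n.
Qed.

Lemma zeta_qE n : (0 < n)%N ->
  cvgn (zeta_series q (2 * n)%N%:R) /\
  zeta_q q (2 * n)%N%:R =
    (-1) ^+ (n - 1)%N * 2 ^+ (2 * n - 1)%N *
    (qBernoulli q (2 * n)%N / (qfactorial q (2 * n)%N)%:C).
Proof.
move=> n0; have [zc _] := zeta_cvg true q01 n0.
have lim : zeta_series q (2 * n)%N%:R @ \oo --> (zeta_value q true n)%:C.
  by rewrite zeta_seriesE; apply: cvg_real_complex.
split; first by apply/cvg_ex; exists (zeta_value q true n)%:C.
rewrite /zeta_q (cvg_lim (@norm_hausdorff _ _) lim) qBernoulliE// half_arg_sqr.
rewrite /bernoulli_coef mul2n odd_double/= doubleK.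
case: n n0 {zc lim} => // n _.
rewrite doubleS !subn1 /= mul0r addr0 rmorphM/= rmorphN rmorph_nat.
rewrite -mul2n [2 ^+ _]exprS exprM -[2 ^+ 2]natrX !exprS.
have h4 : 4 ^+ n != 0 :> R[i] by rewrite expf_neq0// pnatr_eq0.
have sgn := sqrr_sign R[i] n; set e := (-1) ^+ n in sgn *.
rewrite -[LHS]mul1r -{1}sgn; by field.
Qed.

Lemma zeta_star_qE n : (0 < n)%N ->
  cvgn (zeta_star_series q (2 * n)%N%:R) /\
  zeta_star_q q (2 * n)%N%:R =
    (-1) ^+ n * 2 ^+ (2 * n - 2)%N *
    (qEuler q (2 * n - 1)%N / (qfactorial q (2 * n - 1)%N)%:C).
Proof.
move=> n0; have [zc _] := zeta_cvg false q01 n0.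
have lim : zeta_star_series q (2 * n)%N%:R @ \oo --> (- zeta_value q false n)%:C.
  rewrite zeta_star_seriesE; apply: cvg_real_complex; exact: cvgN.
split; first by apply/cvg_ex; exists (- zeta_value q false n)%:C.
rewrite /zeta_star_q (cvg_lim (@norm_hausdorff _ _) lim) qEulerE//.
case: n n0 {zc lim} => // n _.
rewrite -rmorphN/= opprK.
have -> : (2 * n.+1 - 1 = (n.*2).+1)%N by lia.
have -> : (2 * n.+1 - 2 = 2 * n)%N by lia.
rewrite /euler_coef /= odd_double/= mul0r addr0 doubleK.
(* The i left over by the odd power meets the i of [euler_coef], which makes the value real and
   changes its sign. *)
have -> : half_arg R ^+ (n.*2).+1 = half_arg R ^+ (2 * n.+1) * (2 * 'i%C).
  rewrite mul2n doubleS [in RHS]exprSr -mulrA /half_arg mulVf ?mulr1//.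
  exact: two_i_neq0.
rewrite half_arg_sqr exprM -[2 ^+ 2]natrX rmorphM/= rmorphN rmorph_nat !exprS.
have h4 : 4 ^+ n != 0 :> R[i] by rewrite expf_neq0// pnatr_eq0.
have sgn := sqrr_sign R[i] n; set e := (-1) ^+ n in sgn *.
transitivity (- (e ^+ 2 * 'i%C ^+ 2) * (zeta_value q false n.+1)%:C).
  by rewrite sgn sqr_i mul1r opprK mul1r.
by field.
Qed.

End Conclusion.

Theorem corollary4p5 (R : realType) (q : R) (q01 : 0 < q < 1)
    (n : nat) (n_gt0 : (0 < n)%N) :
  (cvgn (zeta_series q (2 * n)%N%:R) /\
   zeta_q q (2 * n)%N%:R =
     (-1) ^+ (n - 1)%N * 2 ^+ (2 * n - 1)%N *
     (qBernoulli q (2 * n)%N / (qfactorial q (2 * n)%N)%:C)) /\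
  (cvgn (zeta_star_series q (2 * n)%N%:R) /\
   zeta_star_q q (2 * n)%N%:R =
     (-1) ^+ n * 2 ^+ (2 * n - 2)%N *
     (qEuler q (2 * n - 1)%N / (qfactorial q (2 * n - 1)%N)%:C)).
Proof. by split; [exact: zeta_qE|exact: zeta_star_qE]. Qed.
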